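(* For any Checkers position on a board of arbitrary size, one can test in polynomial time (in the board size) (i) whether a given checker can become a king by a single move of jumps, and (ii) whether there is a move which wins the game immediately by jumping all of the opponent's pieces.
   Context: Checkers is generalized to arbitrarily large square checkerboards. Pieces of two colors occupy dark squares; each player sits at one side of the board. An ordinary piece (man) moves diagonally forward, toward the opponent's side; a king may move diagonally in both directions. A capture (jump) moves a piece over a diagonally adjacent opponent piece to the vacant square directly beyond it, removing the jumped piece; a single move may consist of a sequence of such jumps by the same piece, with a man only jumping forward and a king jumping in any diagonal direction. A man that reaches the row on the opponent's side of the board becomes a king. Part (ii) asks whether some piece of the player to move has a jump sequence that captures every opposing piece. *)

(* Defs.v *)
From mathcomp Require Import all_boot all_algebra.

Set Implicit Arguments.
Unset Strict Implicit.
Unset Printing Implicit Defensive.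

Inductive color := White | Black.
Inductive rank := Man | King.
Definition piece : Type := color * rank.

Definition opponent (c : color) : color :=
  match c with White => Black | Black => White end.

(* A square is (row, column).  White sits at row 0 and Black at row n - 1. *)
Definition square (n : nat) : Type := 'I_n * 'I_n.

Definition board (n : nat) : Type := {ffun square n -> option piece}.

(* Each player has a dark square in the corner at the left hand. *)
Definition dark n (s : square n) : Prop := ~~ odd (s.1 + s.2).

Definition position n (p : board n) : Prop :=
  forall s, p s <> None -> dark s.

Definition king_row n (c : color) (s : square n) : Prop :=
  match c with White => s.1.+1 = n | Black => s.1 = 0 :> nat end.

(* [true] is the direction of increasing coordinate. *)
Definition next_coord n (up : bool) (i j : 'I_n) : Prop :=
  if up then j = i.+1 :> nat else i = j.+1 :> nat.

(* [t] is the diagonal neighbour of [s] in direction [d] = (rows, columns). *)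
Definition diag_next n (d : bool * bool) (s t : square n) : Prop :=
  next_coord d.1 s.1 t.1 /\ next_coord d.2 s.2 t.2.

Definition forward (c : color) (d : bool * bool) : Prop :=
  match c with White => d.1 = true | Black => d.1 = false end.

Definition may_move (x : piece) (d : bool * bool) : Prop :=
  match x.2 with Man => forward x.1 d | King => True end.

(* [jump p s q t]: the piece on [s] in [p] jumps to [t], which gives [q]. *)
Definition jump n (p : board n) (s : square n) (q : board n) (t : square n) :
    Prop :=
  exists (x y : piece) (d : bool * bool) (m : square n),
    [/\ p s = Some x,
        p m = Some y /\ y.1 = opponent x.1,
        p t = None,
        may_move x d /\ diag_next d s m /\ diag_next d m t
      & q = [ffun u => if u == t then Some x
                       else if (u == s) || (u == m) then None else p u]].

(* A nonempty sequence of jumps by one piece.  The rank of the piece does not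
   change during the sequence: a man on its king row has no forward jump, so
   its move ends there. *)
Inductive jumps n (p : board n) (s : square n) :
    board n -> square n -> Prop :=
  | jumps_one q t : jump p s q t -> jumps p s q t
  | jumps_more q t r u : jump p s q t -> jumps q t r u -> jumps p s r u.

Definition promoted n (p : board n) (t : square n) (q : board n) : Prop :=
  exists x : piece,
    [/\ p t = Some x,
        king_row x.1 t -> q t = Some (x.1, King),
        ~ king_row x.1 t -> q t = Some x
      & forall u, u <> t -> q u = p u].

(* The outcome [q] of a whole move of jumps from [s] to [t]. *)
Definition jump_move n (p : board n) (s : square n) (q : board n)
    (t : square n) : Prop :=
  exists r : board n, jumps p s r t /\ promoted r t q.

Definition can_become_king n (p : board n) (s : square n) (c : color) : Prop :=
  exists (q : board n) (t : square n),
    jump_move p s q t /\ q t = Some (c, King).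

Definition can_win_at_once n (p : board n) (c : color) : Prop :=
  exists (s : square n) (k : rank) (q : board n) (t : square n),
    [/\ p s = Some (c, k), jump_move p s q t
      & forall u k', q u <> Some (opponent c, k')].

(* A machine has registers and, apart from them, an addressable memory, which
   holds the input at the start.  Each instruction takes one unit of time.
   Multiplication is absent because with it numbers could grow doubly
   exponentially; with addition alone, T steps give at most T additional bits,
   so polynomial time on this machine is polynomial time on a Turing machine. *)
Inductive instr :=
  | IConst (d k : nat)     (* reg d := k *)
  | IAdd (d i j : nat)     (* reg d := reg i + reg j *)
  | ISub (d i j : nat)     (* reg d := reg i - reg j, truncated at 0 *)
  | ILoad (d i : nat)      (* reg d := mem (reg i) *)
  | IStore (i j : nat)     (* mem (reg i) := reg j *)
  | IJpos (i l : nat).     (* if reg i > 0, go to instruction l *)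

Definition program := seq instr.

Record config := Config { pc : nat; reg : nat -> nat; mem : nat -> nat }.

Definition step (P : program) (f : config) : config :=
  let: Config a R M := f in
  match onth P a with
  | None => f
  | Some (IConst d k) => Config a.+1 [eta R with d |-> k] M
  | Some (IAdd d i j) => Config a.+1 [eta R with d |-> R i + R j] M
  | Some (ISub d i j) => Config a.+1 [eta R with d |-> R i - R j] M
  | Some (ILoad d i) => Config a.+1 [eta R with d |-> M (R i)] M
  | Some (IStore i j) => Config a.+1 R [eta M with R i |-> R j]
  | Some (IJpos i l) => Config (if 0 < R i then l else a.+1) R M
  end.

Definition initial (input : seq nat) : config :=
  Config 0 (fun=> 0) (nth 0 input).

(* The machine halts when it leaves the program, and then no longer changes. *)
Definition halted (P : program) (f : config) : Prop := size P <= pc f.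

(* The answer is "yes" if and only if register 0 is positive at the end. *)
Definition decides_within (P : program) (input : seq nat) (T : nat)
    (Q : Prop) : Prop :=
  let f := iter T (step P) (initial input) in
  halted P f /\ (0 < reg f 0 <-> Q).

Definition code_color (c : color) : nat :=
  match c with White => 0 | Black => 1 end.

Definition code_square (x : option piece) : nat :=
  match x with
  | None => 0
  | Some (White, Man) => 1
  | Some (White, King) => 2
  | Some (Black, Man) => 3
  | Some (Black, King) => 4
  end.

Definition code_board n (p : board n) : seq nat :=
  [seq code_square (p (i, j)) | i <- enum 'I_n, j <- enum 'I_n].

Definition king_input n (p : board n) (s : square n) : seq nat :=
  [:: n, val s.1, val s.2 & code_board p].

Definition win_input n (p : board n) (c : color) : seq nat :=
  [:: n, code_color c & code_board p].

(* Main.v *)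
Require Import Defs.
From mathcomp Require Import all_boot all_algebra zify.

Set Implicit Arguments.
Unset Strict Implicit.
Unset Printing Implicit Defensive.

(* A sequence of jumps is a trail in the graph whose vertices are the squares
   that are vacant at the start (or hold the jumping piece) and whose edges are
   the enemy pieces; each edge is used at most once, because a jumped piece is
   removed, and the landing squares are never squares of jumped pieces, by parity
   of the row.  A man only moves forward, so its promotion is reachability, and it
   takes everything iff it reaches a square twice as many rows away as there are
   enemy pieces.  A king takes everything iff the graph has an Euler trail from
   its square: all enemy pieces are edges of its component, and either all
   degrees are even or exactly its square and one other have odd degree.  All
   this is evaluated by nested loops over the coordinates, whose nesting depth
   does not depend on the board, so the running time is a polynomial in n. *)

(** * A loop language and its compilation *)

(** Trails cannot be enumerated in polynomial time; Euler's criterion replaces the enumeration by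
    degree counts. To apply it, each enemy piece must be one undirected edge, although it can be
    jumped along two diagonals: the squares reachable from the start meet only one of them, and a
    king can reverse that jump. Reachability is computed as if pieces were never removed. This is
    harmless: a man climbs and so never jumps a piece twice, and for a king reachability only
    delimits the component on which the criterion is tested.

    The program must be the same for all boards, and the machine does not multiply. The tests are
    therefore written in a small language in which every loop and every sum runs over exactly [n]
    values. The time bound is then read off the syntax, and correctness splits into one proof about
    the compiler and one about the formulas. *)

Inductive expr :=
  | EConst (k : nat)
  | EVar (v : nat)
  | EAdd (e1 e2 : expr)
  | ESub (e1 e2 : expr)
  | ELoad (e : expr)
  | ESum (v : nat) (e : expr).

Inductive cmd :=
  | CAssign (v : nat) (e : expr)
  | CStore (e1 e2 : expr)
  | CIf (e : expr) (c : cmd)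
  | CSeq (c1 c2 : cmd)
  | CFor (v : nat) (c : cmd).

Definition upd (E : nat -> nat) (v x w : nat) : nat := if w == v then x else E w.

(** [ESum] is the only binder. Since truth will mean being positive, it serves as existential
    quantifier and as counter, and it also replaces products with [n]. *)
Fixpoint eval (n : nat) (M : nat -> nat) (e : expr) (E : nat -> nat) : nat :=
  match e with
  | EConst k => k
  | EVar v => E v
  | EAdd e1 e2 => eval n M e1 E + eval n M e2 E
  | ESub e1 e2 => eval n M e1 E - eval n M e2 E
  | ELoad e => M (eval n M e E)
  | ESum v e => \sum_(i < n) eval n M e (upd E v i)
  end.

Definition state : Type := (nat -> nat) * (nat -> nat).

(** Resetting the variable after a loop gives it a known final value, so the invariant of the
    compiled loop need not track it. *)
Fixpoint den (n : nat) (c : cmd) (st : state) : state :=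
  match c with
  | CAssign v e => (upd st.1 v (eval n st.2 e st.1), st.2)
  | CStore e1 e2 => (st.1, upd st.2 (eval n st.2 e1 st.1) (eval n st.2 e2 st.1))
  | CIf e c => if 0 < eval n st.2 e st.1 then den n c st else st
  | CSeq c1 c2 => den n c2 (den n c1 st)
  | CFor v c =>
      let st' := foldl (fun st i => den n c (upd st.1 v i, st.2)) st (iota 0 n) in
      (upd st'.1 v 0, st'.2)
  end.

(* Variables live in the even registers; the odd registers hold n, the constants
   1 and 0, and then the temporaries, allocated by nesting depth. *)
Definition usr (v : nat) : nat := v.*2.
Definition tmp (d : nat) : nat := d.*2.+1.

(** The counter is a temporary that is copied to the variable in each round, so the body cannot
    disturb it by assigning the variable. A jump on [tmp 1] is unconditional and adding [tmp 2]
    makes a copy. Five instructions precede the body and two follow it, which explains the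
    offsets. *)
Definition loop_code (a d v : nat) (B : program) : program :=
  [:: IConst (tmp d) 0; ISub (tmp d.+1) (tmp 0) (tmp d);
      IJpos (tmp d.+1) (a + 4); IJpos (tmp 1) (a + 7 + size B);
      IAdd (usr v) (tmp d) (tmp 2)]
  ++ B ++ [:: IAdd (tmp d) (tmp d) (tmp 1); IJpos (tmp 1) (a + 1)].

Lemma size_loop_code a d v B : size (loop_code a d v B) = size B + 7.
Proof. by rewrite /loop_code !size_cat /=; lia. Qed.

(** Jump targets are absolute, hence the address [a]. The result goes to [tmp d]. A sum occupies
    four temporaries (accumulator, saved variable, counter, loop test), so its body is compiled at
    [d.+4]; the saved value is what makes the binding local. *)
Fixpoint compE (a d : nat) (e : expr) : program :=
  match e with
  | EConst k => [:: IConst (tmp d) k]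
  | EVar v => [:: IAdd (tmp d) (usr v) (tmp 2)]
  | EAdd e1 e2 =>
      let C := compE a d e1 in
      C ++ compE (a + size C) d.+1 e2 ++ [:: IAdd (tmp d) (tmp d) (tmp d.+1)]
  | ESub e1 e2 =>
      let C := compE a d e1 in
      C ++ compE (a + size C) d.+1 e2 ++ [:: ISub (tmp d) (tmp d) (tmp d.+1)]
  | ELoad e => compE a d e ++ [:: ILoad (tmp d) (tmp d)]
  | ESum v e =>
      [:: IConst (tmp d) 0; IAdd (tmp d.+1) (usr v) (tmp 2)]
      ++ loop_code (a + 2) d.+2 v
           (compE (a + 7) d.+4 e ++ [:: IAdd (tmp d) (tmp d) (tmp d.+4)])
      ++ [:: IAdd (usr v) (tmp d.+1) (tmp 2)]
  end.

Fixpoint comp (a d : nat) (c : cmd) : program :=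
  match c with
  | CAssign v e => compE a d e ++ [:: IAdd (usr v) (tmp d) (tmp 2)]
  | CStore e1 e2 =>
      let C := compE a d e1 in
      C ++ compE (a + size C) d.+1 e2 ++ [:: IStore (tmp d) (tmp d.+1)]
  | CIf e c =>
      let C := compE a d e in
      let D := comp (a + size C + 2) d c in
      C ++ [:: IJpos (tmp d) (a + size C + 2);
               IJpos (tmp 1) (a + size C + 2 + size D)] ++ D
  | CSeq c1 c2 => let C := comp a d c1 in C ++ comp (a + size C) d c2
  | CFor v c =>
      loop_code a d v (comp (a + 5) d.+2 c) ++ [:: IConst (usr v) 0]
  end.

(** These are upper bounds on the number of steps. A loop spends five steps per round outside its
    body, and four on initialisation and exit; the rest is saving, accumulating and restoring. *)
Fixpoint costE (e : expr) (n : nat) : nat :=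
  match e with
  | EConst _ | EVar _ => 1
  | EAdd e1 e2 | ESub e1 e2 => costE e1 n + costE e2 n + 1
  | ELoad e => costE e n + 1
  | ESum _ e => (costE e n + 6) * n + 7
  end.

Fixpoint cost (c : cmd) (n : nat) : nat :=
  match c with
  | CAssign _ e => costE e n + 1
  | CStore e1 e2 => costE e1 n + costE e2 n + 1
  | CIf e c => costE e n + cost c n + 2
  | CSeq c1 c2 => cost c1 n + cost c2 n
  | CFor _ c => (cost c n + 5) * n + 5
  end.

Definition polyfun (f : nat -> nat) : Prop :=
  exists T : {poly nat}, forall n, (T.[n])%R = f n.

Lemma polyfun_const k : polyfun (fun=> k).
Proof. by exists (k%:P)%R => n; rewrite hornerC. Qed.

Lemma polyfunD f g : polyfun f -> polyfun g -> polyfun (fun n => f n + g n).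
Proof. by move=> [S hS] [T hT]; exists (S + T)%R => n; rewrite hornerD hS hT. Qed.

Lemma polyfunMX f : polyfun f -> polyfun (fun n => f n * n).
Proof. by move=> [S hS]; exists (S * 'X)%R => n; rewrite hornerMX hS. Qed.

Lemma polyfun_costE e : polyfun (costE e).
Proof.
elim: e => [k|v|e1 h1 e2 h2|e1 h1 e2 h2|e h|v e h] /=;
  do ?[exact: polyfun_const | exact: h | exact: h1 | exact: h2
      | apply: polyfunD | apply: polyfunMX].
Qed.

Lemma polyfun_cost c : polyfun (cost c).
Proof.
elim: c => [v e|e1 e2|e c h|c1 h1 c2 h2|v c h] /=;
  do ?[exact: polyfun_const | exact: polyfun_costE | exact: h | exact: h1
      | exact: h2 | apply: polyfunD | apply: polyfunMX].
Qed.

(** * Correctness and time of compiled code *)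

Definition code_at (P : program) (a : nat) (C : program) : Prop :=
  exists pre post, P = pre ++ C ++ post /\ size pre = a.

Lemma code_at_cat P a C D :
  code_at P a (C ++ D) -> code_at P a C /\ code_at P (a + size C) D.
Proof.
move=> [pre [post [-> <-]]]; split; first by exists pre, (D ++ post); rewrite !catA.
by exists (pre ++ C), post; rewrite size_cat !catA.
Qed.

Lemma code_at_cons P a i C :
  code_at P a (i :: C) -> onth P a = Some i /\ code_at P a.+1 C.
Proof.
move=> [pre [post [-> <-]]]; split; first by elim: pre.
by exists (rcons pre i), post; rewrite size_rcons cat_rcons.
Qed.

Lemma code_at_loop P a d v B :
  code_at P a (loop_code a d v B) -> code_at P (a + 5) B.
Proof. by case/code_at_cat=> _ /code_at_cat[]. Qed.

(** The bound is not exact because branches differ in length; idling after the halt absorbs the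
    slack at the end. *)
Definition runs (P : program) (T : nat) (f : config) (Q : config -> Prop) : Prop :=
  exists t, t <= T /\ Q (iter t (step P) f).

Lemma runs0 P T f (Q : config -> Prop) : Q f -> runs P T f Q.
Proof. by exists 0. Qed.

Lemma runsS P T f Q : runs P T (step P f) Q -> runs P T.+1 f Q.
Proof. by move=> [t [le_t h]]; exists t.+1; rewrite iterSr. Qed.

Definition exec (i : instr) (a : nat) (R M : nat -> nat) : config :=
  match i with
  | IConst d k => Config a.+1 (upd R d k) M
  | IAdd d i j => Config a.+1 (upd R d (R i + R j)) M
  | ISub d i j => Config a.+1 (upd R d (R i - R j)) M
  | ILoad d i => Config a.+1 (upd R d (M (R i))) M
  | IStore i j => Config a.+1 R (upd M (R i) (R j))
  | IJpos i l => Config (if 0 < R i then l else a.+1) R M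
  end.

Lemma runs_exec P T a i R M Q :
  onth P a = Some i -> runs P T (exec i a R M) Q -> runs P T.+1 (Config a R M) Q.
Proof. by move=> Pa h; apply: runsS; rewrite /step Pa; case: i {Pa} h. Qed.

Lemma upd_same E v x : upd E v x v = x.
Proof. by rewrite /upd eqxx. Qed.

Lemma upd_diff E v x w : w != v -> upd E v x w = E w.
Proof. by rewrite /upd => /negbTE->. Qed.

Lemma runs_le P T U f Q : runs P T f Q -> T <= U -> runs P U f Q.
Proof. by move=> [t [le_t h]] leTU; exists t; split=> //; apply: leq_trans leTU. Qed.

Lemma runs_trans P T U f Q Q' :
  runs P T f Q -> (forall g, Q g -> runs P U g Q') -> runs P (T + U) f Q'.
Proof.
move=> [t [le_t hQ]] h; have [u [le_u hQ']] := h _ hQ.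
by exists (u + t); rewrite iterD; split=> //; lia.
Qed.

Section Correctness.

Variables (n : nat) (P : program).

Definition consts (R : nat -> nat) : Prop :=
  [/\ R (tmp 0) = n, R (tmp 1) = 1 & R (tmp 2) = 0].

Definition agree (E M R mm : nat -> nat) : Prop :=
  [/\ forall v, R (usr v) = E v, mm =1 M & consts R].

(** One invariant rule for both sums and [CFor]. The invariant must not depend on the counter, the
    loop test or the variable, which the loop itself overwrites, and the body must return the
    counter unchanged. *)
Lemma loop_code_ok a d v B T (I : nat -> (nat -> nat) -> (nat -> nat) -> Prop) R M :
    2 < d -> code_at P a (loop_code a d v B) ->
    (forall i R M, I i R M -> consts R) ->
    (forall i R R' M, I i R M ->
       (forall r, r != tmp d -> r != tmp d.+1 -> r != usr v -> R' r = R r) ->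
       I i R' M) ->
    (forall i R M, i < n -> I i R M -> R (tmp d) = i -> R (usr v) = i ->
       runs P T (Config (a + 5) R M)
         (fun g => [/\ pc g = a + 5 + size B, I i.+1 (reg g) (Defs.mem g)
                     & reg g (tmp d) = i])) ->
    I 0 R M ->
  runs P ((T + 5) * n + 4) (Config a R M)
    (fun g => pc g = a + 7 + size B /\ I n (reg g) (Defs.mem g)).
Proof.
move=> d2 hC Iconst Istable Ibody I0.
have [] := code_at_cat hC => /code_at_cons[c0] /code_at_cons[c1] /code_at_cons[c2].
move=> /code_at_cons[c3] /code_at_cons[c4] _ /code_at_cat[_].
move=> /code_at_cons[c5] /code_at_cons[c6] _ {hC}.
have aE : a + 5 = a.+4.+1 by lia.
have {}c5 : onth P (a + 5 + size B) = Some (IAdd (tmp d) (tmp d) (tmp 1)) := c5.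
have {}c6 : onth P (a + 5 + size B).+1 = Some (IJpos (tmp 1) (a + 1)) := c6.
rewrite aE in c5 c6.
(* Induction on the number [k] of rounds left; the three extra steps are the last test, its jump not
   taken and the jump out. *)
have main k : forall i R M, i + k = n -> I i R M -> R (tmp d) = i ->
    runs P ((T + 5) * k + 3) (Config a.+1 R M)
      (fun g => pc g = a + 7 + size B /\ I n (reg g) (Defs.mem g)).
  have d01 : tmp d != tmp d.+1 by rewrite /tmp; lia.
  have du : tmp d != usr v by rewrite /tmp /usr; lia.
  have [k0 k1 k2] : [/\ tmp 0 != tmp d, tmp 1 != tmp d & tmp 2 != tmp d].
    by rewrite /tmp; split; lia.
  have [l1 l2] : tmp 1 != tmp d.+1 /\ tmp 2 != tmp d.+1.
    by rewrite /tmp; split; lia.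
  elim: k => [|k IHk] i {I0}R {}M hik Ii Ri; have [R0 R1 R2] := Iconst _ _ _ Ii.
    rewrite muln0; apply: (runs_exec c1); apply: (runs_exec c2).
    rewrite /= upd_same R0 Ri -hik addn0 subnn /=; apply: (runs_exec c3).
    apply: runs0; rewrite /= upd_diff // R1 /=; split=> //.
    by apply: Istable Ii _ => r r1 r2 r3; rewrite upd_diff.
  apply: (@runs_le _ (3 + (T + (2 + ((T + 5) * k + 3))))); last by lia.
  apply: (runs_exec c1); apply: (runs_exec c2).
  rewrite /= upd_same R0 Ri.
  have -> : 0 < n - i by lia.
  have -> : a + 4 = a.+4 by lia.
  apply: (runs_exec c4).
  apply: (@runs_trans P T _ _ (fun g => [/\ pc g = a + 5 + size B,
      I i.+1 (reg g) (Defs.mem g) & reg g (tmp d) = i])).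
    rewrite /= -aE; apply: Ibody.
    - by lia.
    - by apply: Istable Ii _ => r r1 r2 r3; rewrite !upd_diff.
    - by rewrite !upd_diff.
    by rewrite upd_same !upd_diff // Ri R2 addn0.
  move=> [b S N] [/= -> IS Si]; have [S0 S1 S2] := Iconst _ _ _ IS.
  rewrite aE; apply: (runs_exec c5); apply: (runs_exec c6).
  rewrite /= upd_diff // S1 addn1; apply: (IHk i.+1); first by lia.
    by apply: Istable IS _ => r r1 r2 r3; rewrite upd_diff.
  by rewrite upd_same Si addn1.
apply: (@runs_le _ ((T + 5) * n + 3).+1); last by lia.
apply: (runs_exec c0); apply: (main n 0) => //.
  by apply: Istable I0 _ => r r1 r2 r3; rewrite upd_diff.
by rewrite upd_same.
Qed.

Opaque loop_code.

(** The last clause protects pending results: the value of the first operand waits in [tmp d] while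
    the second is computed higher up. *)
Lemma compE_ok e : forall a d E M R mm,
    2 < d -> code_at P a (compE a d e) -> agree E M R mm ->
  runs P (costE e n) (Config a R mm)
    (fun g => [/\ pc g = a + size (compE a d e), agree E M (reg g) (Defs.mem g),
       reg g (tmp d) = eval n M e E
     & forall d', d' < d -> reg g (tmp d') = R (tmp d')]).
Proof.
have agree_tmp E M R mm d x : 2 < d -> agree E M R mm ->
    agree E M (upd R (tmp d) x) mm.
  move=> d2 [aE aM [R0 R1 R2]]; split=> // [v|].
    by rewrite upd_diff // /tmp /usr; lia.
  by split; rewrite upd_diff // /tmp; lia.
have low d d' : d' < d -> tmp d' != tmp d by rewrite /tmp; lia.
elim: e => [k|v|e1 h1 e2 h2|e1 h1 e2 h2|e h|v e h] a d E M R mm d2 /= hC hA.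
- have [c0 _] := code_at_cons hC.
  apply: (runs_exec c0); apply: runs0; split; rewrite /= ?upd_same ?addn1 //.
    exact: agree_tmp.
  by move=> d' /low?; rewrite upd_diff.
- have [c0 _] := code_at_cons hC; have [aE aM [R0 R1 R2]] := hA.
  apply: (runs_exec c0); apply: runs0; split; rewrite /= ?upd_same ?addn1 //.
  - exact: agree_tmp.
  - by rewrite aE R2 addn0.
  by move=> d' /low?; rewrite upd_diff.
- have [C1 /code_at_cat[C2 /code_at_cons[c0 _]]] := code_at_cat hC.
  rewrite -addnA; apply: runs_trans (h1 _ _ _ _ _ _ d2 C1 hA) _.
  move=> [b S N] [/= -> A1 v1 t1].
  apply: runs_trans (h2 _ _ _ _ _ _ (ltnW d2 : 2 < d.+1) C2 A1) _.
  move=> [b' S' N'] [/= -> A2 v2 t2].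
  apply: (runs_exec c0); apply: runs0; split=> /=.
  - by rewrite !size_cat /=; lia.
  - exact: agree_tmp.
  - by rewrite upd_same v2 t2 // v1.
  by move=> d' ld; rewrite upd_diff ?low // t2 ?t1 // ltnW.
- have [C1 /code_at_cat[C2 /code_at_cons[c0 _]]] := code_at_cat hC.
  rewrite -addnA; apply: runs_trans (h1 _ _ _ _ _ _ d2 C1 hA) _.
  move=> [b S N] [/= -> A1 v1 t1].
  apply: runs_trans (h2 _ _ _ _ _ _ (ltnW d2 : 2 < d.+1) C2 A1) _.
  move=> [b' S' N'] [/= -> A2 v2 t2].
  apply: (runs_exec c0); apply: runs0; split=> /=.
  - by rewrite !size_cat /=; lia.
  - exact: agree_tmp.
  - by rewrite upd_same v2 t2 // v1.
  by move=> d' ld; rewrite upd_diff ?low // t2 ?t1 // ltnW.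
- have [C1 /code_at_cons[c0 _]] := code_at_cat hC.
  apply: runs_trans (h _ _ _ _ _ _ d2 C1 hA) _ => -[b S N] [/= -> A1 v1 t1].
  apply: (runs_exec c0); apply: runs0; split=> /=.
  - by rewrite !size_cat /=; lia.
  - exact: agree_tmp.
  - by rewrite upd_same v1; case: A1.
  by move=> d' ld; rewrite upd_diff ?low // t1.
have [c0 /code_at_cons[c1]] := code_at_cons hC.
have aS : a.+2 = a + 2 by lia.
rewrite aS => /code_at_cat[CL /code_at_cons[c2 _]].
have [aE aM [R0 R1 R2]] := hA.
have du d' w : tmp d' != usr w by rewrite /tmp /usr; lia.
(* The accumulator holds a partial sum and [tmp d.+1] the outer value of [v]; the register of [v]
   itself is left free. *)
pose I i (S N : nat -> nat) :=
  [/\ forall w, w != v -> S (usr w) = E w, N =1 M /\ consts S,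
      S (tmp d) = \sum_(j < i) eval n M e (upd E v j),
      S (tmp d.+1) = E v & forall d', d' < d -> S (tmp d') = R (tmp d')].
apply: (@runs_le _ (2 + (((costE e n + 1 + 5) * n + 4) + 1))); last by lia.
apply: (runs_exec c0); apply: (runs_exec c1).
rewrite /= aS.
set B := (X in loop_code _ _ _ X) in CL c2 *.
have CB : code_at P (a + 7) B.
  by have := code_at_loop CL; have -> : a + 2 + 5 = a + 7 by lia.
apply: runs_trans.
  apply: (loop_code_ok (I := I) (T := costE e n + 1) _ CL).
  - by lia.
  - by move=> i S N [_ []].
  - move=> i S S' N [I1 [I2 [S0 S1 S2]] I3 I4 I5] hS.
    split; first by move=> w wv; rewrite hS ?I1 // /tmp /usr; lia.
    + by split=> //; split; rewrite hS // /tmp /usr; lia.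
    + by rewrite hS // /tmp /usr; lia.
    + by rewrite hS // /tmp /usr; lia.
    by move=> d' ld; rewrite hS ?I5 // /tmp /usr; lia.
  - move=> i S N ltin [I1 [I2 [S0 S1 S2]] I3 I4 I5] Sd Sv.
    have [CB1 /code_at_cons[c3 _]] := code_at_cat CB.
    have -> : a + 2 + 5 = a + 7 by lia.
    apply: (runs_trans (h _ _ (upd E v i) M S N _ CB1 _)); first by lia.
      split=> // w; rewrite /upd; case: eqP => [->//|/eqP wv]; exact: I1.
    move=> [b U L] [/= -> [U1 U2 [U3 U4 U5]] U6 U7].
    apply: (runs_exec c3); apply: runs0; split=> /=.
    + by rewrite size_cat /=; lia.
    + split.
      * move=> w wv; rewrite upd_diff ?U1 ?upd_diff //.
        by rewrite eq_sym.
      * by split=> //; split; rewrite upd_diff // low //; lia.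
      * by rewrite upd_same big_ord_recr /= U6 U7 ?I3 //; lia.
      * by rewrite upd_diff ?U7 // /tmp; lia.
      * by move=> d' ld; rewrite upd_diff ?U7 ?I5 ?low //; lia.
    by rewrite upd_diff ?U7 //; rewrite /tmp; lia.
  split.
  - by move=> w wv; rewrite !upd_diff ?aE // eq_sym.
  - by split=> //; split; rewrite !upd_diff // low //; lia.
  - by rewrite big_ord0 upd_diff ?upd_same // low.
  - have k2 : tmp 2 != tmp d by rewrite /tmp; lia.
    by rewrite upd_same !upd_diff // 1?eq_sym // aE R2 addn0.
  - by move=> d' ld; rewrite !upd_diff // low //; lia.
move=> [b S N] [/= -> [I1 [I2 [S0 S1 S2]] I3 I4 I5]].
have {}c2 : onth P (a + 2 + 7 + size B) = Some (IAdd (usr v) (tmp d.+1) (tmp 2)).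
  by rewrite -c2; congr onth; rewrite size_loop_code; lia.
apply: (runs_exec c2); apply: runs0; split=> /=.
- by rewrite size_cat size_loop_code /=; lia.
- split=> //.
    move=> w; rewrite I4 S2 addn0 /upd.
    have -> : (usr w == usr v) = (w == v) by rewrite /usr; lia.
    by case: eqP => [->//|/eqP wv]; exact: I1.
  by split; rewrite upd_diff.
- by rewrite upd_diff.
- by move=> d' ld; rewrite upd_diff ?I5.
Qed.

Lemma comp_ok c : forall a d st R mm,
    2 < d -> code_at P a (comp a d c) -> agree st.1 st.2 R mm ->
  runs P (cost c n) (Config a R mm)
    (fun g => [/\ pc g = a + size (comp a d c),
       agree (den n c st).1 (den n c st).2 (reg g) (Defs.mem g)
     & forall d', d' < d -> reg g (tmp d') = R (tmp d')]).
Proof.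
have du d' w : tmp d' != usr w by rewrite /tmp /usr; lia.
have agree_usr E M R mm v x :
    agree E M R mm -> agree (upd E v x) M (upd R (usr v) x) mm.
  move=> [aE aM [R0 R1 R2]]; split=> // [w|]; last by split; rewrite upd_diff.
  rewrite /upd; have -> : (usr w == usr v) = (w == v) by rewrite /usr; lia.
  by rewrite aE.
elim: c => [v e|e1 e2|e c h|c1 h1 c2 h2|v c h] a d [E M] R mm d2 /= hC hA.
- have [C1 /code_at_cons[c0 _]] := code_at_cat hC.
  apply: runs_trans (compE_ok d2 C1 hA) _ => -[b S N] [/= -> A1 v1 t1].
  apply: (runs_exec c0); apply: runs0; split=> /=.
  - by rewrite !size_cat /=; lia.
  - by have [_ _ [_ _ ->]] := A1; rewrite addn0 v1; apply: agree_usr.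
  by move=> d' ld; rewrite upd_diff ?t1.
- have [C1 /code_at_cat[C2 /code_at_cons[c0 _]]] := code_at_cat hC.
  rewrite -addnA; apply: runs_trans (compE_ok d2 C1 hA) _.
  move=> [b S N] [/= -> A1 v1 t1].
  apply: runs_trans (compE_ok (ltnW d2 : 2 < d.+1) C2 A1) _.
  move=> [b' S' N'] [/= -> [aE aM aR] v2 t2].
  apply: (runs_exec c0); apply: runs0; split=> /=.
  - by rewrite !size_cat /=; lia.
  - by split=> // x; rewrite v2 t2 // v1 /upd aM.
  by move=> d' ld; rewrite t2 ?t1 // ltnW.
- have [C1 /code_at_cons[c0 /code_at_cons[c1 C2]]] := code_at_cat hC.
  rewrite -addnA; apply: runs_trans (compE_ok d2 C1 hA) _.
  move=> [b S N] [/= -> A1 v1 t1].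
  have aE : (a + size (compE a d e)).+2 = a + size (compE a d e) + 2 by lia.
  rewrite addnC; apply: (runs_exec c0); rewrite /= v1.
  case: ifP => _.
    apply: runs_le (leqnSn _); rewrite aE in C2.
    have [t [le_t [p1 p2 p3]]] := h _ _ (E, M) _ _ d2 C2 A1.
    exists t; split=> //; split=> //.
      by rewrite p1 size_cat /=; lia.
    by move=> d' ld; rewrite p3 ?t1.
  apply: (runs_exec c1); apply: runs0; have [_ _ [_ S1 _]] := A1.
  rewrite /= S1 /=; split=> //.
  by rewrite size_cat /=; lia.
- have [C1 C2] := code_at_cat hC.
  apply: runs_trans (h1 _ _ (E, M) _ _ d2 C1 hA) _ => -[b S N] [/= -> A1 t1].
  have [t [le_t [p1 p2 p3]]] := h2 _ _ _ _ _ d2 C2 A1.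
  exists t; split=> //; split=> //.
    by rewrite p1 size_cat; lia.
  by move=> d' ld; rewrite p3 ?t1.
have [CL /code_at_cons[c0 _]] := code_at_cat hC.
have [aE aM [R0 R1 R2]] := hA.
pose st i := foldl (fun st i => den n c (upd st.1 v i, st.2)) (E, M) (iota 0 i).
pose I i (S N : nat -> nat) :=
  [/\ forall w, w != v -> S (usr w) = (st i).1 w, N =1 (st i).2, consts S
    & forall d', d' < d -> S (tmp d') = R (tmp d')].
set B := (X in loop_code _ _ _ X) in CL c0 *.
have CB : code_at P (a + 5) B := code_at_loop CL.
apply: (@runs_le _ (((cost c n + 5) * n + 4) + 1)); last by lia.
apply: runs_trans.
  apply: (loop_code_ok (I := I) (T := cost c n) _ CL) => //.
  - by move=> i S N [].
  - move=> i S S' N [I1 I2 [S0 S1 S2] I5] hS.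
    split=> //.
    + by move=> w wv; rewrite hS ?I1 // /tmp /usr; lia.
    + by split; rewrite hS // /tmp /usr; lia.
    by move=> d' ld; rewrite hS ?I5 // /tmp /usr; lia.
  - move=> i S N ltin [I1 I2 I3 I5] Sd Sv.
    have := h _ d.+2 (upd (st i).1 v i, (st i).2) S N _ CB.
    case; first by lia.
      split=> //= w; rewrite /upd; case: eqP => [->//|/eqP wv]; exact: I1.
    move=> t [le_t [p1 [p2 p2' p2''] p3]]; exists t; split=> //.
    have stS : st i.+1 = den n c (upd (st i).1 v i, (st i).2).
      by rewrite /st -addn1 iotaD foldl_cat.
    split=> //; first (split=> //; rewrite ?stS //).
      by move=> d' ld; rewrite p3 ?I5 //; lia.
    by rewrite p3.
move=> [b S N] [/= -> [I1 I2 I3 I5]].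
have {}c0 : onth P (a + 7 + size B) = Some (IConst (usr v) 0).
  by rewrite -c0; congr onth; rewrite size_loop_code; lia.
apply: (runs_exec c0); apply: runs0; split=> /=.
- by rewrite size_cat size_loop_code /=; lia.
- have [S0 S1 S2] := I3; split=> //; last by split; rewrite upd_diff.
  move=> w; rewrite /upd.
  have -> : (usr w == usr v) = (w == v) by rewrite /usr; lia.
  by case: eqP => // /eqP wv; exact: I1.
by move=> d' ld; rewrite upd_diff ?I5.
Qed.

End Correctness.

(** Registers start at 0, so [tmp 2] already holds its constant and serves as the address of cell 0,
    where the input has [n]. Depth 3 lies just above the three constants. *)
Definition compile (c : cmd) : program :=
  [:: IConst (tmp 1) 1; ILoad (tmp 0) (tmp 2)] ++ comp 2 3 c.

Lemma compile_ok c : exists T : {poly nat}, forall n input (Q : Prop),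
  nth 0 input 0 = n ->
  (0 < (den n c (fun=> 0, nth 0 input)).1 0 <-> Q) ->
  decides_within (compile c) input (T.[n])%R Q.
Proof.
have [T hT] : polyfun (fun n => cost c n + 2).
  by apply: polyfunD (polyfun_cost c) (polyfun_const 2).
exists T => n input Q hn hQ; rewrite /decides_within hT.
have C0 : code_at (compile c) 0 (compile c) by exists [::], [::]; rewrite cats0.
have [/code_at_cons[c0 /code_at_cons[c1 _]] C1] := code_at_cat C0.
have [t [le_t [halt ans]]] : runs (compile c) (cost c n + 2) (initial input)
    (fun g => halted (compile c) g /\ (0 < reg g 0 <-> Q)).
  rewrite addnC; apply: (runs_exec c0); apply: (runs_exec c1).
  have hA : agree n (fun=> 0) (nth 0 input)
      (upd (upd (fun=> 0) (tmp 1) 1) (tmp 0) (nth 0 input 0)) (nth 0 input).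
    by split=> // v; rewrite !upd_diff // /tmp /usr; lia.
  have [t [le_t [p1 [p2 _ _] _]]] :=
    comp_ok (st := (fun=> 0, nth 0 input)) (isT : 2 < 3) C1 hA.
  exists t; split=> //; split; first by rewrite /halted p1 size_cat.
  by rewrite -hQ (p2 0).
(* The run may halt early; a halted machine keeps its state until the prescribed time. *)
have stop k g : halted (compile c) g -> iter k (step (compile c)) g = g.
  move=> hg; elim: k => //= k ->; case: g hg => b R M /= hg.
  by rewrite onth_default.
by rewrite -(subnK le_t) iterD stop.
Qed.

(** * Euler trails *)

Section Trails.

Variables (V E : eqType) (inc : E -> V -> V -> bool).

(** Edges may repeat here; that they are distinct is said separately by [uniq (unzip1 P)]. [inc]
    need not be symmetric, so the same notion describes a man, who only moves forward. *)
Fixpoint trail (u : V) (P : seq (E * V)) : bool :=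
  if P is (e, v) :: P' then inc e u v && trail v P' else true.

Definition tend (u : V) (P : seq (E * V)) : V := last u (unzip2 P).

Lemma trail_cat u P Q : trail u (P ++ Q) = trail u P && trail (tend u P) Q.
Proof. by elim: P u => //= -[e v] P IH u; rewrite IH andbA. Qed.

Lemma tend_cat u P Q : tend u (P ++ Q) = tend (tend u P) Q.
Proof. by rewrite /tend /unzip2 map_cat last_cat. Qed.

End Trails.

Section Euler.

Variables (V E : finType) (inc : E -> V -> V -> bool).

Definition incident (e : E) (v : V) : bool := [exists w, inc e v w].
Definition deg (v : V) : nat := #|[pred e | incident e v]|.

(** With the next hypothesis: every edge that occurs has exactly two ends, and can be crossed both
    ways because [incident] asks for a departure from each end. *)
Hypothesis inc_irr : forall e u, ~~ inc e u u.
Hypothesis incidentE : forall e u v x,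
  inc e u v -> incident e x = (x == u) || (x == v).

Local Notation trail := (trail inc).
Local Notation used x P := (count (incident^~ x) (unzip1 P)).

(** Each passage through a vertex uses one incidence to enter and one to leave, so only the two ends
    of the trail can be odd, and they cancel if they coincide. *)
Lemma trail_parity u P x :
  trail u P -> odd (used x P) = (x == u) (+) (x == tend u P).
Proof.
elim: P u => [|[e v] P IH] u /=; first by rewrite /tend /= addbb.
case/andP=> uv vP; rewrite oddD oddb (IH _ vP) (incidentE _ uv) /tend /=.
have : u != v by apply: contraTneq uv => ->; exact: inc_irr.
case: (eqVneq x u) => [->|_ _] => [/negbTE->|] /=; case: (x == v) => //=.
by case: (_ == _).
Qed.

Lemma deg_split x (L : seq E) : uniq L ->
  deg x = count (incident^~ x) L + #|[pred e | incident e x && (e \notin L)]|.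
Proof.
move=> uL; rewrite /deg -(cardID [in L] [pred e | incident e x]); congr (_ + _).
  rewrite -size_filter -(card_uniqP (filter_uniq _ uL)).
  by apply: eq_card => e; rewrite !inE mem_filter.
by apply: eq_card => e; rewrite !inE andbC.
Qed.

Lemma deg_saturated x (L : seq E) : uniq L ->
  (forall e, incident e x -> e \in L) -> deg x = count (incident^~ x) L.
Proof.
move=> uL h; rewrite (deg_split x uL) eq_card0 ?addn0 // => e.
by rewrite !inE; apply/negP => /andP[/h->].
Qed.

(** Walk greedily along edges outside [L] until none is left at the current vertex; each step
    shrinks the complement of [L]. *)
Lemma saturated_trail (L : seq E) v :
  exists Q, [/\ trail v Q, uniq (unzip1 Q), all [predC L] (unzip1 Q)
    & forall e, incident e (tend v Q) -> e \in L ++ unzip1 Q].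
Proof.
have [k] := ubnP #|[predC L]|; elim: k L v => // k IH L v ltk.
have [/existsP[e /andP[/existsP[w vw] eL]]|no] :=
    boolP [exists e, incident e v && (e \notin L)]; last first.
  exists [::]; split=> //= e ev; rewrite cats0.
  by apply: contraR no => eL; apply/existsP; exists e; rewrite ev.
have [|Q [tQ uQ dQ sQ]] := IH (e :: L) w.
  rewrite -ltnS; apply: leq_trans ltk; rewrite ltnS (cardD1 e [predC L]) inE eL.
  by rewrite add1n ltnS subset_leq_card //; apply/subsetP => x; rewrite !inE negb_or.
exists ((e, w) :: Q); split=> /=; rewrite ?vw ?eL //=.
- rewrite uQ andbT; apply/negP => /(allP dQ); by rewrite !inE eqxx.
- by apply: sub_all dQ => x; rewrite !inE negb_or => /andP[].
move=> f /sQ; rewrite !(inE, mem_cat).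
by rewrite orbCA.
Qed.

Variable s : V.
Hypothesis conn : forall e u, incident e u ->
  connect (fun u v => [exists e, inc e u v]) s u.

(** The boolean is read as 0 or 1: an even [s] allows no odd vertex elsewhere, an odd [s] requires
    exactly one. *)
Definition euler_parity : bool :=
  #|[pred t | (t != s) && odd (deg t)]| == odd (deg s).

Lemma euler_trail_parity P : trail s P -> uniq (unzip1 P) ->
  (forall e u, incident e u -> e \in unzip1 P) -> euler_parity.
Proof.
move=> tP uP full.
have odd_deg t : odd (deg t) = (t == s) (+) (t == tend s P).
  by rewrite (deg_saturated uP) ?(trail_parity _ tP) // => e; apply: full.
rewrite /euler_parity odd_deg eqxx /=.
have [st|ne] := eqVneq s (tend s P); last first.
  rewrite (@eq_card _ _ (pred1 (tend s P))) ?card1 // => t; rewrite !inE odd_deg.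
  case: (eqVneq t (tend s P)) => [->|_]; first by rewrite eq_sym (negbTE ne).
  by case: (t == s).
by rewrite eq_card0 // => t; rewrite !inE odd_deg -st addbb andbF.
Qed.

Lemma euler_trail : euler_parity ->
  exists P, [/\ trail s P, uniq (unzip1 P)
    & forall e u, incident e u -> e \in unzip1 P].
Proof.
move=> /eqP par.
suff main k : forall P, #|E| - size P < k -> trail s P -> uniq (unzip1 P) ->
    (forall e, incident e (tend s P) -> e \in unzip1 P) ->
    exists P, [/\ trail s P, uniq (unzip1 P)
      & forall e u, incident e u -> e \in unzip1 P].
  have [P [tP uP _ sP]] := saturated_trail [::] s.
  exact: main (ltnSn _) tP uP sP.
elim: k => // k IH P ltk tP uP sP.
have [full|] := boolP [forall e, forall u, incident e u ==> (e \in unzip1 P)].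
  by exists P; split=> // e u; move/forallP/(_ e)/forallP/(_ u)/implyP: full.
rewrite negb_forall => /existsP[e0]; rewrite negb_forall => /existsP[u0].
rewrite negb_imply => /andP[e0u0 e0P].
(* The unused edges leave every vertex with even degree, so a saturated trail in
   them is closed and can be spliced into P. *)
have even_rest x : ~~ odd #|[pred e | incident e x && (e \notin unzip1 P)]|.
  have -> : odd #|[pred e | incident e x && (e \notin unzip1 P)]| =
      odd (deg x) (+) (x == s) (+) (x == tend s P).
    rewrite (deg_split x uP) oddD (trail_parity _ tP) -addbA addbAC addbA.
    by case: (x == s); case: (x == tend s P); case: (odd _).
  (* [P] is saturated at its end, so that vertex has odd degree exactly when [P] is open. By [par]
     the odd vertices are then the two ends of an open [P], and there are none if [P] is closed. *)
  have odd_end : odd (deg (tend s P)) = (tend s P != s).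
    by rewrite (deg_saturated uP sP) (trail_parity _ tP) eqxx addbT.
  have [xs|nxs] := eqVneq x s.
    rewrite xs; have [e|ne] := eqVneq s (tend s P).
      by rewrite {1}e odd_end -e eqxx.
    move: par; rewrite (cardD1 (tend s P)) inE odd_end eq_sym ne /=.
    by case: (odd (deg s)).
  have [xe|nxe] := eqVneq x (tend s P).
    by rewrite {1}xe odd_end -xe nxs.
  rewrite /= !addbF; apply/negP => ox.
  have [e|ne] := eqVneq s (tend s P).
    move: par odd_end; rewrite -e eqxx /= => par od.
    by move: par; rewrite od (cardD1 x) inE nxs ox.
  move: par; rewrite (cardD1 (tend s P)) inE odd_end eq_sym ne /=.
  rewrite (cardD1 x) !inE nxs ox nxe /=.
  by case: (odd (deg s)).
have [v vP [f fv fP]] : exists2 v, v \in s :: unzip2 P &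
    exists2 f, incident f v & f \notin unzip1 P.
  have [/existsP[v /andP[vP /existsP[f /andP[fv fP]]]]|no] := boolP [exists v,
      (v \in s :: unzip2 P) && [exists f, incident f v && (f \notin unzip1 P)]].
    by exists v => //; exists f.
  have all_used v f : v \in s :: unzip2 P -> incident f v -> f \in unzip1 P.
    move=> vP fv; apply: contraR no => fP; apply/existsP; exists v; rewrite vP.
    by apply/existsP; exists f; rewrite fv.
  have ends f u v : inc f u v -> f \in unzip1 P -> v \in s :: unzip2 P.
    move=> uv fP.
    have : forall a, trail a P -> v \in a :: unzip2 P.
      elim: (P) fP => [//|[g b] P' IHP] /=; rewrite inE.
      case/orP=> [/eqP <-|fP'] a /andP[ab bP].
        have : incident f v.
          by rewrite (incidentE _ uv) eqxx orbT.
        by rewrite (incidentE _ ab) !inE => /orP[]->; rewrite ?orbT.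
      by rewrite inE (IHP fP' _ bP) orbT.
    exact.
  case/negP: e0P; apply: (all_used u0) => //.
  have /connectP[p pp ->] := conn e0u0.
  suff main z : path (fun u v => [exists e, inc e u v]) z p ->
      z \in s :: unzip2 P -> last z p \in s :: unzip2 P.
    by apply: main pp _; rewrite mem_head.
  elim: p z {pp} => //= w p IHp z /andP[/existsP[g zw] wp] zP.
  apply: IHp wp _; apply: ends (zw) _; apply: (all_used z) => //.
  by apply/existsP; exists w.
have [Q [tQ uQ dQ sQ]] := saturated_trail (unzip1 P) v.
(* At the end of [Q] all edges left over by [P] belong to [Q]; an open [Q] would use an odd number
   of them, against [even_rest]. *)
have closed_Q : tend v Q = v.
  apply/eqP/negPn/negP => ne; have /negP[] := even_rest (tend v Q).
  have -> : #|[pred e | incident e (tend v Q) && (e \notin unzip1 P)]|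
      = used (tend v Q) Q.
    rewrite -size_filter -(card_uniqP (filter_uniq _ uQ)).
    apply: eq_card => e; rewrite !inE mem_filter.
    case ev: (incident e (tend v Q)) => //=; have := sQ _ ev; rewrite mem_cat.
    have := allP dQ e; rewrite !inE.
    by case: (e \in unzip1 P); case: (e \in unzip1 Q) => //= ->.
  by rewrite (trail_parity _ tQ) eqxx (negbTE ne).
have sizeQ : 0 < size Q.
  by case: Q sQ {tQ uQ dQ closed_Q} => // /(_ f fv); rewrite cats0 (negbTE fP).
have [P1 [P2 [PE P1v]]] : exists P1 P2, P = P1 ++ P2 /\ tend s P1 = v.
  move: vP; rewrite inE => /orP[/eqP->|/mapP[[e w] ewP ->]]; first by exists [::], P.
  have [P1 P2] := splitPr ewP.
  by exists (rcons P1 (e, w)), P2; rewrite cat_rcons /tend /unzip2 map_rcons last_rcons.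
have perm : perm_eq (unzip1 (P1 ++ Q ++ P2)) (unzip1 P ++ unzip1 Q).
  by rewrite PE /unzip1 !map_cat -catA perm_cat2l perm_catC.
have uPQ : uniq (unzip1 P ++ unzip1 Q).
  rewrite cat_uniq uP uQ andbT /= -all_predC.
  by apply: sub_all dQ => x; rewrite !inE.
(* The measure is a truncated subtraction, so it strictly drops only because the longer trail still
   fits into [E]. *)
have sPQ : size P + size Q <= #|E|.
  by have := card_uniqP uPQ; rewrite size_cat !size_map => <-; exact: max_card.
apply: (IH (P1 ++ Q ++ P2)).
- by move: ltk sPQ sizeQ; rewrite PE !size_cat; clear; lia.
- by move: tP; rewrite PE !trail_cat P1v tQ closed_Q.
- by rewrite (perm_uniq perm).
move=> e; rewrite !tend_cat P1v closed_Q (perm_mem perm) mem_cat.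
by rewrite -P1v -tend_cat -PE => /sP->.
Qed.

End Euler.

(** * Jumps as trails *)

(** One coordinate of a jump from [i] over [j] to [k]; the flags permit the two directions. Rows and
    columns are independent, and only rows are restricted by rank and colour. *)
Definition line3 (up down : bool) (i j k : nat) : bool :=
  (up && (j == i.+1) && (k == j.+1)) || (down && (i == j.+1) && (j == k.+1)).

Lemma square_eqE n (a b : square n) :
  (a == b) = (a.1 == b.1 :> nat) && (a.2 == b.2 :> nat).
Proof. by case: a b => [? ?] [? ?]. Qed.

Section Board.

Variables (n : nat) (p : board n) (s : square n).

(** Colour, rank and enmity are read off the input codes, so that the formulas of the program can
    mirror these definitions term by term. *)
Definition code (u : square n) : nat := code_square (p u).
Definition black : bool := 2 < code s.
Definition king : bool := (code s == 2) || (code s == 4).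
Definition enemy (m : square n) : bool := (0 < code m) && ((2 < code m) != black).

Definition capture (m u v : square n) : bool :=
  [&& enemy m, (code v == 0) || (v == s),
      line3 (king || ~~ black) (king || black) u.1 m.1 v.1
    & line3 true true u.2 m.2 v.2].

Definition reach (u : square n) : bool :=
  connect (fun u v => [exists m, capture m u v]) s u.

Definition on_king_row (t : square n) : bool :=
  if black then t.1 == 0 :> nat else t.1.+1 == n.

Definition promotes : bool := [exists t, [&& t != s, reach t & on_king_row t]].

(** [capture] does not ask its departure square to be free and admits both diagonals through a
    piece. Reachability repairs both, as the Euler criterion needs. *)
Definition live (m u v : square n) : bool := reach u && capture m u v.

(* Degrees are at most 4, one edge per diagonal direction. *)
Definition odd_degree (t : square n) : bool :=
  (deg live t == 1) || (deg live t == 3).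

(** A move has at least one jump, hence the demand for an enemy piece, respectively for [t != s].
    The two truncated differences add up to the distance in rows. *)
Definition wins : bool :=
  if king then
    [&& [exists m, enemy m],
        [forall m, enemy m ==> [exists u, exists v, live m u v]]
      & #|[pred t | (t != s) && odd_degree t]| == odd_degree s]
  else [exists t, [&& t != s, reach t
                    & (t.1 - s.1) + (s.1 - t.1) == #|enemy| + #|enemy|]].

(** The board in the middle of a move depends only on the set of captured squares and the present
    square. The present square is tested first because the piece may be back on [s]. *)
Definition after (L : seq (square n)) (x : square n) : board n :=
  [ffun u => if u == x then p s else if (u == s) || (u \in L) then None else p u].

Lemma code0 u : (code u == 0) -> p u = None.
Proof. by rewrite /code; case: (p u) => [[[] []]|]. Qed.

Lemma line3_diag ok1 ok2 i j k : line3 ok1 ok2 i j k ->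
  exists2 b : bool, if b then ok1 else ok2 & (if b then j = i.+1 else i = j.+1) /\
    (if b then k = j.+1 else j = k.+1).
Proof.
by case/orP=> /andP[/andP[h /eqP h1] /eqP h2]; [exists true | exists false].
Qed.

Lemma diag_line3 (ok1 ok2 b : bool) i j k : (if b then ok1 else ok2) ->
  (if b then j = i.+1 else i = j.+1) -> (if b then k = j.+1 else j = k.+1) ->
  line3 ok1 ok2 i j k.
Proof. by rewrite /line3; case: b => -> -> ->; rewrite !eqxx ?orbT. Qed.

(** * Moves of one piece and the trails they follow *)

Section Moves.

Variable x : piece.
Hypothesis psx : p s = Some x.

(** The invariant of a move. Landing squares keep the row parity of [s] and captured squares have
    the other one, so no landing square was vacated by a capture. *)
Definition valid (L : seq (square n)) (u : square n) : Prop :=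
  [/\ odd u.1 = odd s.1, (code u == 0) || (u == s)
    & forall m, m \in L -> odd m.1 = ~~ odd s.1].

Lemma may_moveE d : may_move x d <->
  (if d.1 then king || ~~ black else king || black).
Proof.
by rewrite /king /black /code psx /may_move; case: x d => [[] []] [[] []]; split.
Qed.

Lemma enemyE y m : p m = Some y -> (y.1 = opponent x.1) <-> enemy m.
Proof.
by move=> pm; rewrite /enemy /black /code psx pm; case: x y pm => [[] []] [[] []]; split.
Qed.

Lemma capture_parity m u v : capture m u v ->
  odd m.1 = ~~ odd u.1 /\ odd v.1 = odd u.1.
Proof.
by case/and4P=> _ _ /line3_diag[[] _ []] + + _; move=> -> -> /=; rewrite ?negbK.
Qed.

Lemma capture_valid L m u v : valid L u -> capture m u v -> valid (m :: L) v.
Proof.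
move=> [ou fu oL] c; have [om ov] := capture_parity c; split.
- by rewrite ov.
- by case/and4P: c.
by move=> m'; rewrite inE => /orP[/eqP->|/oL//]; rewrite om ou.
Qed.

(** A square that is vacant now was vacant at first, is [s], or was captured; parity rules out the
    last case for a landing square. Captures so far thus matter only through [m \notin L]. *)
Lemma jump_after L u q v : valid L u ->
  jump (after L u) u q v <->
  exists2 m, (m \notin L) && capture m u v & q = after (m :: L) v.
Proof.
move=> val; have [ou fu oL] := val.
have result m : m \notin L -> capture m u v ->
    [ffun w => if w == v then Some x
       else if (w == u) || (w == m) then None else after L u w] = after (m :: L) v.
  move=> mL c; apply/ffunP => w; rewrite !ffunE psx inE.
  case: (w == v) => //; case: (eqVneq w u) => [->|wu] /=.
    case/orP: fu => [/code0 pu|/eqP ->]; last by rewrite eqxx.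
    by rewrite pu if_same.
  by case: (w == m); rewrite ?orbT.
split=> [[x' [y [[d1 d2] [m [ax [am yx] av [mm [[/= r1 c1] [/= r2 c2]]] ->]]]]]|].
  have {ax}ex : x' = x by move: ax; rewrite ffunE eqxx psx => -[].
  subst x'.
  have om : odd m.1 = ~~ odd s.1.
    by rewrite -ou; case: d1 {mm r2} r1 => /= ->; rewrite ?negbK.
  have ov : odd v.1 = odd s.1.
    by apply: negb_inj; rewrite -om; case: d1 {mm r1} r2 => /= ->; rewrite ?negbK.
  have ms : m != s by apply: contra_eq_neq om => ->; case: odd.
  have mu : m != u by apply: contra_eq_neq om => ->; rewrite ou; case: odd.
  have vu : v != u.
    apply/eqP => vu; move: r1 r2; rewrite vu; clear; case: d1 => /=; lia.
  move: am; rewrite ffunE (negbTE mu) (negbTE ms) /=.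
  case: ifP => // mL pm.
  have c : capture m u v.
    rewrite /capture (proj1 (enemyE pm) yx) /=; apply/and3P; split.
    - move: av; rewrite ffunE (negbTE vu); case: (eqVneq v s) => [->|vs] /=.
        by rewrite orbT.
      case: ifP => [/oL|_]; last by rewrite /code => ->.
      by rewrite ov; case: odd.
    - by apply: (@diag_line3 _ _ d1) => //; exact: (proj1 (may_moveE (d1, d2)) mm).
    - by apply: (@diag_line3 _ _ d2) => //; case: (d2).
  by exists m; rewrite ?mL // result ?mL.
move=> [m /andP[mL c] ->].
have [om ov] := capture_parity c.
have [em fv /line3_diag[b1 ok1 [r1 r1']] /line3_diag[b2 _ [r2 r2']]] := and4P c.
have ms : m != s by apply: contra_eq_neq om => ->; rewrite ou; case: odd.
have mu : m != u by apply: contra_eq_neq om => ->; case: odd.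
have vu : v != u.
  by apply/eqP => vu; move: r1 r1'; rewrite vu; clear; case: b1 => /=; lia.
have [y pm] : exists y, p m = Some y.
  by case/andP: (em); rewrite /code; case: (p m) => // y _ _; exists y.
exists x, y, (b1, b2), m; split.
- by rewrite ffunE eqxx.
- rewrite ffunE (negbTE mu) (negbTE ms) (negbTE mL) /=; split=> //.
  exact: (proj2 (enemyE pm)).
- rewrite ffunE (negbTE vu); case: ifP => // /norP[vs _].
  by case/orP: fv => [/code0|/eqP e] //; rewrite e eqxx in vs.
- by split; [apply/(may_moveE (b1, b2)) | split; split].
- by rewrite result.
Qed.

Lemma eq_after L L' u : L =i L' -> after L u = after L' u.
Proof. by move=> e; apply/ffunP => w; rewrite !ffunE e. Qed.

Lemma jumps_after L u q v : valid L u ->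
  jumps (after L u) u q v <->
  exists P, [/\ 0 < size P, trail capture u P, uniq (unzip1 P),
    all [predC L] (unzip1 P) & tend u P = v /\ q = after (unzip1 P ++ L) v].
Proof.
move=> val; split.
  move e0: (after L u) => p0 js.
  elim: js L val e0 => {p0 u q v} [p0 u q v|p0 u q v r w] j => [|_ IH] L val e0;
      move: j; rewrite -e0 => /(jump_after _ _ val)[m /andP[mL c] qE].
    by exists [:: (m, v)]; rewrite /= c mL.
  have [P [P0 tP uP dP [wE rE]]] := IH _ (capture_valid val c) (esym qE).
  exists ((m, v) :: P); rewrite /= c mL; split=> //.
  - by rewrite uP andbT; apply/negP => /(allP dP); rewrite !inE eqxx.
  - by apply: sub_all dP => z; rewrite !inE negb_or => /andP[].
  split=> //; rewrite rE; apply: eq_after => z.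
  by rewrite !(inE, mem_cat) orbCA.
move=> [P [P0 tP uP dP [<- ->]]].
elim: P L u val P0 tP uP dP => // -[m w] P IH L u val _ /=.
move=> /andP[c tP] /andP[mP uP] /andP[mL dP].
have j : jump (after L u) u (after (m :: L) w) w.
  by apply/(jump_after _ _ val); exists m; rewrite // mL.
case: P IH tP uP dP mP => [_ _ _ _ _|b P IH tP uP dP mP]; first exact: jumps_one.
apply: jumps_more j _; rewrite /tend /=.
have -> : after (m :: unzip1 (b :: P) ++ L) (last w (unzip2 (b :: P))) =
    after (unzip1 (b :: P) ++ (m :: L)) (tend w (b :: P)).
  by apply: eq_after => z; rewrite !(inE, mem_cat) [RHS]orbCA.
apply: (IH (m :: L) w (capture_valid val c)) => //.
apply/allP => z zP; rewrite !inE negb_or; have := allP dP z zP; rewrite !inE => ->.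
by rewrite andbT; apply: contraNneq mP => <-.
Qed.

Lemma after_start : after [::] s = p.
Proof. by apply/ffunP => u; rewrite ffunE; case: eqP => [->|]. Qed.

Lemma valid_start : valid [::] s.
Proof. by split=> //; rewrite eqxx orbT. Qed.

Lemma jumpsE q v : jumps p s q v <->
  exists P, [/\ 0 < size P, trail capture s P, uniq (unzip1 P), tend s P = v
    & q = after (unzip1 P) v].
Proof.
rewrite -{1}after_start; split.
  move/(jumps_after _ _ valid_start) => [P [P0 tP uP _ [vE qE]]].
  by exists P; rewrite cats0 in qE.
move=> [P [P0 tP uP vE qE]]; apply/(jumps_after _ _ valid_start).
by exists P; rewrite cats0; split=> //; apply/allP.
Qed.

Lemma reachP v : reflect (exists2 P, trail capture s P & tend s P = v) (reach v).
Proof.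
apply: (iffP connectP) => [[q pq ->]|[P tP <-]].
  elim: q s pq => [|w q IH] u /=; first by exists [::].
  case/andP=> /existsP[m c] /IH[P tP <-].
  by exists ((m, w) :: P); rewrite /= ?c.
exists (unzip2 P) => //.
elim: P s tP => //= -[m w] P IH u /andP[c tP]; rewrite IH // andbT.
by apply/existsP; exists m.
Qed.

Lemma man_trail u P : ~~ king -> trail capture u P ->
  let h (w : square n) := if black then n - w.1 else w.1 in
  [/\ h (tend u P) = h u + (size P).*2, uniq (unzip1 P)
    & all (fun m => h u < h m) (unzip1 P)].
Proof.
move=> nk tP h.
have climb m a b : capture m a b -> h m = (h a).+1 /\ h b = (h a).+2.
  case/and4P=> _ _; rewrite /h /line3 (negbTE nk) /=.
  have := ltn_ord a.1; have := ltn_ord b.1; have := ltn_ord m.1.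
  by case: black => /=; lia.
clearbody h; elim: P u tP => [|[m w] P IH] u; first by rewrite /tend /= addn0.
rewrite /tend /= => /andP[/climb[hm hw] /IH[]]; rewrite /tend => -> uP aP.
split; first by rewrite hw doubleS !addSn !addnS.
  rewrite uP andbT; apply/negP => /(allP aP).
  by rewrite hw hm ltnNge leqnSn.
by rewrite hm leqnn; apply: sub_all aP => z; rewrite hw => /ltnW/ltnW.
Qed.

Lemma trail_enemy u P : trail capture u P -> all enemy (unzip1 P).
Proof. by elim: P u => //= -[m w] P IH u /andP[/andP[-> _] /IH]. Qed.

Lemma trail_free u P : trail capture u P -> (code u == 0) || (u == s) ->
  (code (tend u P) == 0) || (tend u P == s).
Proof.
by elim: P u => //= -[m w] P IH u /andP[/and4P[_ fw _ _]] /IH /(_ fw).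
Qed.

Lemma king_rowP t : reflect (king_row x.1 t) (on_king_row t).
Proof.
by rewrite /on_king_row /black /code psx; case: x => [[] []]; exact: eqP.
Qed.

Lemma promotesE c : x = (c, Man) -> can_become_king p s c <-> promotes.
Proof.
move=> xE; have nk : ~~ king by rewrite /king /code psx xE; case: c {xE}.
split=> [[q [t [[r [/jumpsE[P [P0 tP uP <- ->]] [y [ry q1 q2 _]]]] qt]]]|].
  move: ry; rewrite ffunE eqxx psx => -[yE]; subst y.
  apply/existsP; exists (tend s P); apply/and3P; split.
  - have [hP _ _] := man_trail nk tP.
    by apply: contraTneq P0 => e; move: hP; rewrite e; lia.
  - by apply/reachP; exists P.
  apply/king_rowP; case: (king_rowP (tend s P)) => // /q2.
  by rewrite qt xE.
case/existsP=> t /and3P[ts /reachP[P tP tE] /king_rowP kt].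
have [_ uP _] := man_trail nk tP.
exists [ffun u => if u == t then Some (c, King) else after (unzip1 P) t u], t.
split; last by rewrite ffunE eqxx.
exists (after (unzip1 P) t); split.
  apply/jumpsE; exists P; split=> //; rewrite lt0n size_eq0.
  by apply: contraNneq ts => P0; rewrite -tE P0.
exists x; split; first by rewrite ffunE eqxx.
- by rewrite ffunE eqxx xE.
- by [].
by move=> u /eqP/negbTE ut; rewrite ffunE ut.
Qed.

Definition sweeps (P : seq (square n * square n)) : Prop :=
  [/\ 0 < size P, trail capture s P, uniq (unzip1 P)
    & forall m, enemy m -> m \in unzip1 P].

Lemma sweepsE :
  (exists q t, jump_move p s q t /\ forall u k, q u <> Some (opponent x.1, k))
  <-> exists P, sweeps P.
Proof.
have enemy_s : ~~ enemy s by rewrite /enemy eqxx andbF.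
have other (c : color) k : Some (c, k) <> Some (opponent c, k) by case: c.
split=> [[q [t [[r [/jumpsE[P [P0 tP uP <- ->]] [y [ry _ _ qE]]]] none]]]|].
  exists P; split=> // m em; have [z pm] : exists z, p m = Some z.
    by case/andP: (em); rewrite /code; case: (p m) => // z _ _; exists z.
  have zc := proj2 (enemyE pm) em.
  have ms : m != s by apply: contraNneq enemy_s => <-.
  have mt : m != tend s P.
    apply: contraTneq em => ->; have := trail_free tP; rewrite eqxx orbT => /(_ isT).
    by case/orP=> [e|/eqP->//]; rewrite /enemy (eqP e).
  apply/negPn/negP => mP; apply: (none m z.2).
  rewrite qE; last exact/eqP.
  by rewrite ffunE (negbTE mt) (negbTE ms) (negbTE mP) pm -zc; case: (z).
move=> [P [P0 tP uP full]].
have [q pq] : exists q,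
    promoted (after (unzip1 P) (tend s P)) (tend s P) q.
  exists [ffun u => if u == tend s P then
    Some (if on_king_row (tend s P) then (x.1, King) else x)
    else after (unzip1 P) (tend s P) u].
  exists x; rewrite !ffunE eqxx; split=> //.
  - by move/king_rowP->.
  - by move/king_rowP/negbTE->.
  by move=> u /eqP/negbTE ut; rewrite !ffunE ut.
exists q, (tend s P); split.
  by exists (after (unzip1 P) (tend s P)); split=> //; apply/jumpsE; exists P.
case: pq => y [ay q1 q2 qE] u k qu.
move: ay; rewrite ffunE eqxx psx => -[yE]; subst y.
have [uE|/eqP ut] := eqVneq u (tend s P).
  have [kr|kr] := boolP (on_king_row u); move: qu; rewrite uE.
    by rewrite q1; [case: (x) => [[] ?] | apply/king_rowP; rewrite -uE].
  by rewrite q2; [case: (x) => [[] ?] | apply/king_rowP; rewrite -uE].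
move: qu; rewrite qE // ffunE (introF eqP ut); case: ifP => // /norP[_ uP'] pu.
by case/negP: uP'; apply: full; apply/(enemyE pu).
Qed.

Lemma live_reach m u v : live m u v -> reach v.
Proof.
case/andP=> ru c; apply: connect_trans ru (connect1 _).
by apply/existsP; exists m.
Qed.

Lemma trail_live u P : reach u -> trail live u P = trail capture u P.
Proof.
elim: P u => //= -[m w] P IH u ru; rewrite {1}/live ru /=.
case c: (capture m u w) => //=; apply: IH.
by apply: (@live_reach m u); rewrite /live ru.
Qed.

(** The jumped pieces are distinct enemies and their number is half the distance in rows, so
    comparing cardinals decides whether they are all. *)
Lemma sweeps_man : ~~ king -> (exists P, sweeps P) <->
  [exists t, [&& t != s, reach t
               & (t.1 - s.1) + (s.1 - t.1) == #|enemy| + #|enemy|]].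
Proof.
move=> nk; have rows P : trail capture s P ->
    ((tend s P).1 - s.1) + (s.1 - (tend s P).1) = (size P).*2.
  case/(man_trail nk) => + _ _.
  have := ltn_ord s.1; have := ltn_ord (tend s P).1.
  by case: black => /=; lia.
have sub P : trail capture s P -> {subset unzip1 P <= enemy}.
  by move=> tP m /(allP (trail_enemy tP)).
split=> [[P [P0 tP uP full]]|/existsP[t /and3P[ts /reachP[P tP tE] /eqP cE]]].
  apply/existsP; exists (tend s P); apply/and3P; split.
  - by apply: contraTneq P0 => e; move: (rows P tP); rewrite e subnn; case: (size P).
  - by apply/reachP; exists P.
  rewrite rows // -(size_map fst) -addnn -(card_uniqP uP).
  have -> // : #|enemy| = #|unzip1 P|.
  by apply: eq_card => m; apply/idP/idP => [/full|/(sub P tP)].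
have [_ uP _] := man_trail nk tP.
exists P; split=> //.
  rewrite lt0n size_eq0; apply: contraNneq ts => P0.
  by rewrite -tE P0.
have cP : #|unzip1 P| = #|enemy|.
  rewrite (card_uniqP uP) size_map; apply: double_inj.
  by rewrite -(rows P tP) tE cE addnn.
have sPe : unzip1 P \subset enemy by apply/subsetP => w /(sub P tP).
by move=> m em; rewrite ((subset_cardP cP) sPe).
Qed.

(* The two diagonals through an enemy piece end in different classes of row +
   column modulo 4, so that only one of them is an edge of the component of s. *)
Lemma capture_class m u v : capture m u v -> (u.1 + u.2) %% 4 = (v.1 + v.2) %% 4.
Proof.
case/and4P=> _ _ /line3_diag[b1 _ [r1 r1']] /line3_diag[b2 _ [r2 r2']].
by move: r1 r1' r2 r2'; clear; case: b1; case: b2; lia.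
Qed.

Lemma reach_class u : reach u -> (s.1 + s.2) %% 4 = (u.1 + u.2) %% 4.
Proof.
case/reachP=> P + <-; elim: P (s) => //= -[m w] P IH v /andP[/capture_class-> /IH].
by [].
Qed.

Lemma reach_free u : reach u -> (code u == 0) || (u == s).
Proof. by case/reachP=> P /trail_free h <-; apply: h; rewrite eqxx orbT. Qed.

Lemma live_irr m u : ~~ live m u u.
Proof.
apply/negP => /andP[_ /and4P[_ _ /line3_diag[[] _ [h h']] _]]; lia.
Qed.

(** This is where a king is an undirected traveller: the reverse jump lands on [u], which is free
    because it is reachable. *)
Lemma live_incident (k : king) m u v w :
  live m u v -> incident live m w = (w == u) || (w == v).
Proof.
move=> luv; have /andP[ru c] := luv; have rv := live_reach luv.
apply/idP/idP => [/existsP[z /andP[rw c']]|/orP[]/eqP->]; last 2 first.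
- by apply/existsP; exists v.
- apply/existsP; exists u; rewrite /live rv /=; case/and4P: c => em _ l1 l2.
  apply/and4P; split=> //; first exact: reach_free.
    by move: l1; rewrite /line3 k /=; lia.
  by move: l2; rewrite /line3 /=; lia.
(* Both departure squares lie in the class of [s] modulo 4, which forces them onto the same diagonal
   through [m]. *)
have := reach_class ru; have := reach_class rw.
case/and4P: c => _ _; case/and4P: c' => _ _; rewrite /line3 k /=.
by rewrite !square_eqE; lia.
Qed.

Lemma live_deg (k : king) u : deg live u <= 4.
Proof.
rewrite /deg; pose f (d : bool * bool) := odflt u [pick m : square n |
  (if d.1 then m.1 == u.1.+1 :> nat else u.1 == m.1.+1 :> nat)
  && (if d.2 then m.2 == u.2.+1 :> nat else u.2 == m.2.+1 :> nat)].
apply: (@leq_trans #|[set f d | d : bool * bool]|).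
  apply/subset_leq_card/subsetP => m; rewrite inE => /existsP[v /andP[_]].
  case/and4P=> _ _ /line3_diag[b1 _ [r1 _]] /line3_diag[b2 _ [r2 _]].
  apply/imsetP; exists (b1, b2) => //; rewrite /f /=.
  case: pickP => [m' /andP[h1 h2]|/(_ m)] /=.
    case: m r1 r2 => i j; case: m' h1 h2 => i' j' /= h1 h2 r1 r2.
    by congr (_, _); apply: val_inj; case: b1 b2 h1 h2 r1 r2 => [] [] /=; lia.
  by case: b1 b2 r1 r2 => [] [] /= -> ->; rewrite !eqxx.
by apply: leq_trans (leq_imset_card _ _) _; rewrite card_prod card_bool.
Qed.

Lemma sweeps_king (k : king) : (exists P, sweeps P) <->
    [&& [exists m, enemy m],
        [forall m, enemy m ==> [exists u, exists v, live m u v]]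
      & #|[pred t | (t != s) && odd_degree t]| == odd_degree s].
Proof.
have rs : reach s by exact: connect0.
have incE := live_incident k.
have odd_deg u : odd_degree u = odd (deg live u).
  rewrite /odd_degree; move: (live_deg k u).
  by case: (deg live u) => [|[|[|[|[|?]]]]].
have parE : euler_parity live s =
    (#|[pred t | (t != s) && odd_degree t]| == odd_degree s).
  rewrite /euler_parity odd_deg; congr (_ == _).
  by apply: eq_card => t; rewrite !inE odd_deg.
have incident_enemy m u : incident live m u -> enemy m.
  by case/existsP=> v /andP[_ /andP[]].
rewrite -parE; split=> [[P [P0 tP uP full]]|/and3P[/existsP[m0 em0] /forallP cov par]].
  have tP' : trail live s P by rewrite trail_live.
  apply/and3P; split.
  - case: P P0 tP {uP full tP'} => // -[m v] P _ /trail_enemy /= /andP[em _].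
    by apply/existsP; exists m.
  - apply/forallP => m; apply/implyP => /full.
    elim: (P) (s) tP' => //= -[m' w] P' IH u /andP[l tP'].
    rewrite inE => /orP[/eqP->|/(IH _ tP')//].
    by apply/existsP; exists u; apply/existsP; exists w.
  apply: (euler_trail_parity live_irr incE tP' uP) => m u /incident_enemy.
  exact: full.
(* [reach] is connectivity under [capture]; [trail_live] transfers it to the edges of the Euler
   graph. *)
have conn m u : incident live m u ->
    connect (fun u v => [exists m, live m u v]) s u.
  case/existsP=> v /andP[/reachP[P tP <-] _]; rewrite -(trail_live _ rs) in tP.
  elim: P (s) tP => [|[m' w] P IH] a /=; first by rewrite connect0.
  case/andP=> l /IH; apply: connect_trans; apply: connect1.
  by apply/existsP; exists m'.
have [P [tP uP full]] := euler_trail live_irr incE conn par.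
have full' m : enemy m -> m \in unzip1 P.
  move=> em; have /existsP[u iu] := implyP (cov m) em; exact: full iu.
exists P; split=> //; last by rewrite -trail_live.
by have := full' m0 em0; case: (P).
Qed.

Lemma winsE :
  (exists q t, jump_move p s q t /\ forall u k, q u <> Some (opponent x.1, k))
  <-> wins.
Proof.
rewrite /wins sweepsE; case: ifP => k; first exact: sweeps_king.
exact/sweeps_man/negbT.
Qed.
End Moves.
End Board.

(** * The search program *)

(** Squares take pairs of variables from 1 on, because variable 0 compiles to register 0, which
    carries the answer. *)
Definition rowv (a : nat) : nat := a.*2.+1.
Definition colv (a : nat) : nat := a.*2.+2.

(** Truth is positivity, as for the jump instruction and the answer, so [EAdd] is disjunction.
    Normalising by [bPos] is needed only where truth values are counted or compared. *)
Definition bNot (e : expr) : expr := ESub (EConst 1) e.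
Definition bPos (e : expr) : expr := bNot (bNot e).
Definition bAnd (e f : expr) : expr := bNot (EAdd (bNot e) (bNot f)).
Definition bEq (e f : expr) : expr := bNot (EAdd (ESub e f) (ESub f e)).
Definition bEx (a : nat) (e : expr) : expr := ESum (rowv a) (ESum (colv a) e).
Definition eCount (a : nat) (e : expr) : expr := bEx a (bPos e).
Definition cForS (a : nat) (c : cmd) : cmd := CFor (rowv a) (CFor (colv a) c).

(* Variable 0 is free to be bound here: a sum restores it. *)
Definition eIndex (a : nat) : expr :=
  EAdd (ESum 0 (EVar (rowv a))) (EVar (colv a)).
Definition eCode (o a : nat) : expr := ELoad (EAdd (EConst o) (eIndex a)).
(* The n * n cells after the board hold the marks of the reachability search. *)
Definition eCell (o a : nat) : expr :=
  EAdd (EAdd (EConst o) (ESum 0 (ESum 0 (EConst 1)))) (eIndex a).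
Definition eMark (o a : nat) : expr := ELoad (eCell o a).

Definition eSame (a b : nat) : expr :=
  bAnd (bEq (EVar (rowv a)) (EVar (rowv b))) (bEq (EVar (colv a)) (EVar (colv b))).
Definition eBlack (o a : nat) : expr := ESub (eCode o a) (EConst 2).
Definition eKing (o : nat) : expr :=
  EAdd (bEq (eCode o 0) (EConst 2)) (bEq (eCode o 0) (EConst 4)).
Definition eEnemy (o a : nat) : expr :=
  bAnd (eCode o a) (bNot (bEq (bPos (eBlack o a)) (bPos (eBlack o 0)))).
Definition eLine (up down : expr) (i j k : nat) : expr :=
  EAdd (bAnd (bAnd up (bEq (EVar j) (EAdd (EVar i) (EConst 1))))
             (bEq (EVar k) (EAdd (EVar j) (EConst 1))))
       (bAnd (bAnd down (bEq (EVar i) (EAdd (EVar j) (EConst 1))))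
             (bEq (EVar j) (EAdd (EVar k) (EConst 1)))).
Definition eCapture (o m u v : nat) : expr :=
  bAnd (eEnemy o m)
  (bAnd (EAdd (bEq (eCode o v) (EConst 0)) (eSame v 0))
  (bAnd (eLine (EAdd (eKing o) (bNot (eBlack o 0))) (EAdd (eKing o) (eBlack o 0))
           (rowv u) (rowv m) (rowv v))
        (eLine (EConst 1) (EConst 1) (colv u) (colv m) (colv v)))).
Definition eLive (o m u v : nat) : expr := bAnd (eMark o u) (eCapture o m u v).

Definition ePromotes (o : nat) : expr :=
  bEx 1 (bAnd (bNot (eSame 1 0)) (bAnd (eMark o 1)
    (EAdd (bAnd (eBlack o 0) (bEq (EVar (rowv 1)) (EConst 0)))
          (bAnd (bNot (eBlack o 0))
                (bEq (EAdd (EVar (rowv 1)) (EConst 1)) (ELoad (EConst 0))))))).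

Definition eOddDegree (o a : nat) : expr :=
  let d := eCount 2 (bEx 3 (eLive o 2 a 3)) in
  EAdd (bEq d (EConst 1)) (bEq d (EConst 3)).

Definition eWins (o : nat) : expr :=
  EAdd
    (bAnd (eKing o)
      (bAnd (bEx 2 (eEnemy o 2))
      (bAnd (bNot (bEx 2 (bNot
               (EAdd (bNot (eEnemy o 2)) (bEx 3 (bEx 4 (eLive o 2 3 4)))))))
            (bEq (eCount 1 (bAnd (bNot (eSame 1 0)) (eOddDegree o 1)))
                 (bPos (eOddDegree o 0))))))
    (bAnd (bNot (eKing o))
      (bEx 1 (bAnd (bNot (eSame 1 0)) (bAnd (eMark o 1)
        (bEq (EAdd (ESub (EVar (rowv 1)) (EVar (rowv 0)))
                   (ESub (EVar (rowv 0)) (EVar (rowv 1))))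
             (EAdd (eCount 2 (eEnemy o 2)) (eCount 2 (eEnemy o 2)))))))).

Definition cRound (o : nat) : cmd :=
  cForS 1 (CIf (bEx 2 (bEx 3 (eLive o 2 3 1))) (CStore (eCell o 1) (EConst 1))).

(** Memory persists from one start to the next, so the marks are wiped each time. Slot 5 merely
    counts the [n * n] rounds. *)
Definition cSearch (o : nat) (sel acc : expr) : cmd :=
  cForS 0 (CIf sel
    (CSeq (cForS 1 (CStore (eCell o 1) (EConst 0)))
    (CSeq (CStore (eCell o 0) (EConst 1))
    (CSeq (cForS 5 (cRound o))
          (CIf acc (CAssign 0 (EConst 1))))))).

(** * Meaning of the formulas *)

Section Eval.

Variable n : nat.
Implicit Types (E M : nat -> nat) (e f : expr) (u v : square n).

Definition updS E a u : nat -> nat := upd (upd E (rowv a) u.1) (colv a) u.2.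
Definition holds E a u : Prop := E (rowv a) = u.1 /\ E (colv a) = u.2.
Definition tr M e E : bool := 0 < eval n M e E.

Lemma holds_same E a u : holds (updS E a u) a u.
Proof.
by rewrite /holds /updS !upd_same upd_diff ?upd_same // /rowv /colv; lia.
Qed.

Lemma holds_diff E a b u v : a != b -> holds E b v -> holds (updS E a u) b v.
Proof.
by move=> ab [h1 h2]; rewrite /holds /updS !upd_diff //; rewrite /rowv /colv; lia.
Qed.

Lemma tr_Not M e E : tr M (bNot e) E = ~~ tr M e E.
Proof. by rewrite /tr /=; lia. Qed.

Lemma tr_Pos M e E : eval n M (bPos e) E = tr M e E.
Proof. by rewrite /tr /=; lia. Qed.

Lemma tr_And M e f E : tr M (bAnd e f) E = tr M e E && tr M f E.
Proof. by rewrite /tr /=; lia. Qed.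

Lemma tr_Add M e f E : tr M (EAdd e f) E = tr M e E || tr M f E.
Proof. by rewrite /tr /=; lia. Qed.

Lemma tr_Eq M e f E : tr M (bEq e f) E = (eval n M e E == eval n M f E).
Proof. by rewrite /tr /=; lia. Qed.

Lemma tr_Const M k E : tr M (EConst k) E = (0 < k).
Proof. by []. Qed.

Lemma eval_Ex M a e E : eval n M (bEx a e) E = \sum_u eval n M e (updS E a u).
Proof.
by rewrite /= pair_bigA.
Qed.

Lemma tr_Ex M a e E : tr M (bEx a e) E = [exists u, tr M e (updS E a u)].
Proof.
rewrite /tr eval_Ex lt0n sum_nat_eq0 negb_forall.
by apply: eq_existsb => u; rewrite lt0n.
Qed.

Lemma eval_Count M a e E :
  eval n M (eCount a e) E = #|[pred u | tr M e (updS E a u)]|.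
Proof.
rewrite eval_Ex -sum1_card [RHS]big_mkcond; apply: eq_bigr => u _.
by rewrite -[eval n M _ _]/(eval n M (bPos e) _) tr_Pos inE; case: tr.
Qed.

Definition offset u : nat := n * u.1 + u.2.

Lemma offset_lt u : offset u < n * n.
Proof.
by rewrite /offset; case: u => i j /=; have := ltn_ord i; have := ltn_ord j; nia.
Qed.

Lemma offset_inj : injective offset.
Proof.
move=> [i j] [i' j']; rewrite /offset /= ![n * _]mulnC => e.
have nn : 0 < n by apply: leq_ltn_trans (ltn_ord i).
congr (_, _); apply: val_inj => /=.
  by have := congr1 (divn^~ n) e; rewrite /= !divnMDl // !divn_small ?addn0.
by have := congr1 (modn^~ n) e; rewrite /= !modnMDl !modn_small.
Qed.

(** Summing the row number [n] times stands in for the missing multiplication. *)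
Lemma eval_Index M a u E : holds E a u -> eval n M (eIndex a) E = offset u.
Proof.
move=> [h1 h2]; rewrite /= /offset h2; congr (_ + _).
by rewrite -h1 sum_nat_const card_ord.
Qed.

Lemma eval_Cell M o a u E :
  holds E a u -> eval n M (eCell o a) E = o + n * n + offset u.
Proof.
move=> h; rewrite -[eval n M (eCell o a) E]/(eval n M (EAdd _ _) E).
rewrite -(eval_Index M h) /=; congr (_ + _ + _).
by rewrite sum_nat_const sum_nat_const card_ord muln1.
Qed.

End Eval.

Section Formulas.

Variables (n : nat) (p : board n) (s : square n) (o : nat) (M : nat -> nat).

Hypothesis codeM : forall u, M (o + offset u) = code p u.

Definition mark u : bool := 0 < M (o + n * n + offset (n := n) u).

Lemma eval_Code E a u : holds E a u -> eval n M (eCode o a) E = code p u.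
Proof.
move=> h; rewrite -[LHS]/(M (o + eval n M (eIndex a) E)).
by rewrite (eval_Index _ h) codeM.
Qed.

Lemma tr_Mark E a (u : square n) : holds E a u -> tr n M (eMark o a) E = mark u.
Proof.
move=> h; rewrite /tr -[eval n M _ _]/(M (eval n M (eCell o a) E)).
by rewrite (eval_Cell _ _ h).
Qed.

Lemma tr_Same E a b (u v : square n) :
  holds E a u -> holds E b v -> tr n M (eSame a b) E = (u == v).
Proof.
move=> [h1 h2] [k1 k2].
by rewrite tr_And !tr_Eq /= h1 h2 k1 k2 square_eqE.
Qed.

Lemma tr_Black E a u : holds E a u -> tr n M (eBlack o a) E = (2 < code p u).
Proof.
move=> h; rewrite /tr -[eval n M _ _]/(eval n M (eCode o a) E - 2).
by rewrite (eval_Code h) subn_gt0.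
Qed.

Variable E : nat -> nat.
Hypothesis hs : holds E 0 s.

Lemma tr_King : tr n M (eKing o) E = king p s.
Proof. by rewrite tr_Add !tr_Eq (eval_Code hs). Qed.

Lemma tr_Enemy a m : holds E a m -> tr n M (eEnemy o a) E = enemy p s m.
Proof.
move=> h; rewrite tr_And tr_Not tr_Eq !tr_Pos (tr_Black h) (tr_Black hs).
by rewrite /tr (eval_Code h) /enemy /black; case: (2 < code p m); case: (2 < code p s).
Qed.

Lemma tr_Line up down i j k :
  tr n M (eLine up down i j k) E =
  line3 (tr n M up E) (tr n M down E) (E i) (E j) (E k).
Proof. by rewrite tr_Add !tr_And !tr_Eq /= !addn1. Qed.

Lemma tr_Capture a b c m u v : holds E a m -> holds E b u -> holds E c v ->
  tr n M (eCapture o a b c) E = capture p s m u v.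
Proof.
move=> hm hu hv; rewrite 3!tr_And (tr_Enemy hm) tr_Add tr_Eq (eval_Code hv).
rewrite (tr_Same hv hs) !tr_Line !(tr_Add _ _ (eKing o)).
rewrite (tr_Not _ _ (eBlack o 0)) tr_King (tr_Black hs) !tr_Const.
by case: hm hu hv => -> -> [-> ->] [-> ->].
Qed.

Lemma tr_Live a b c m u v : holds E a m -> holds E b u -> holds E c v ->
  tr n M (eLive o a b c) E = mark u && capture p s m u v.
Proof. by move=> hm hu hv; rewrite tr_And (tr_Mark hu) (tr_Capture hm hu hv). Qed.

End Formulas.

Section Acceptance.

Variables (n : nat) (p : board n) (s : square n) (o : nat) (M : nat -> nat).
Variable E : nat -> nat.

Hypothesis codeM : forall u, M (o + offset u) = code p u.
Hypothesis markM : forall u, mark o M u = reach p s u.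
Hypothesis hs : holds E 0 s.

Lemma tr_Promotes : M 0 = n -> tr n M (ePromotes o) E = promotes p s.
Proof.
move=> Mn; rewrite tr_Ex; apply: eq_existsb => t.
have hs1 : holds (updS E 1 t) 0 s by exact: holds_diff.
have ht : holds (updS E 1 t) 1 t by exact: holds_same.
rewrite 2!tr_And tr_Not (tr_Same M ht hs1) (tr_Mark o M ht) markM.
rewrite tr_Add !tr_And tr_Not !tr_Eq (tr_Black codeM hs1).
rewrite /on_king_row /black; case: ht => /= -> _; rewrite Mn addn1.
by case: (2 < code p s); rewrite ?orbF.
Qed.

(** The formula binds slots 2 and 3, so the square under test must sit in another slot. *)
Lemma tr_OddDegree F a t : 2 != a -> 3 != a ->
  holds F 0 s -> holds F a t -> tr n M (eOddDegree o a) F = odd_degree p s t.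
Proof.
move=> a2 a3 h0 ht.
have -> : odd_degree p s t = (eval n M (eCount 2 (bEx 3 (eLive o 2 a 3))) F == 1)
    || (eval n M (eCount 2 (bEx 3 (eLive o 2 a 3))) F == 3).
  rewrite eval_Count /odd_degree; have -> // : deg (live p s) t =
    #|[pred u : square n | tr n M (bEx 3 (eLive o 2 a 3)) (updS F 2 u)]|.
  apply: eq_card => m; rewrite !inE tr_Ex; apply: eq_existsb => v.
  have h0' : holds (updS (updS F 2 m) 3 v) 0 s by do 2 apply: holds_diff => //.
  have ht' : holds (updS (updS F 2 m) 3 v) a t by do 2 apply: holds_diff => //.
  have hm : holds (updS (updS F 2 m) 3 v) 2 m.
    by apply: holds_diff => //; exact: holds_same.
  by rewrite (tr_Live codeM h0' hm ht' (holds_same _ _ _)) markM.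
by rewrite tr_Add !tr_Eq.
Qed.

Lemma tr_Wins : tr n M (eWins o) E = wins p s.
Proof.
rewrite tr_Add (tr_And _ _ (eKing o)) (tr_And _ _ (bNot (eKing o))).
rewrite (tr_Not _ _ (eKing o)) (tr_King codeM hs) /wins.
case: ifP => _; rewrite ?andbF ?andbT ?orbF /=.
  rewrite 2!tr_And; congr [&& _, _ & _].
  - rewrite tr_Ex; apply: eq_existsb => m.
    by rewrite (tr_Enemy codeM (holds_diff _ _ hs) (holds_same _ _ _)).
  - rewrite tr_Not tr_Ex negb_exists; apply: eq_forallb => m.
    have h0 : holds (updS E 2 m) 0 s by exact: holds_diff.
    have hm : holds (updS E 2 m) 2 m by exact: holds_same.
    rewrite tr_Not tr_Add tr_Not (tr_Enemy codeM h0 hm) tr_Ex negbK implybE.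
    congr (_ || _); apply: eq_existsb => u; rewrite tr_Ex; apply: eq_existsb => v.
    have h0' : holds (updS (updS (updS E 2 m) 3 u) 4 v) 0 s.
      by do 2 apply: holds_diff => //.
    have hm' : holds (updS (updS (updS E 2 m) 3 u) 4 v) 2 m.
      by do 2 apply: holds_diff => //.
    have hu : holds (updS (updS (updS E 2 m) 3 u) 4 v) 3 u.
      by apply: holds_diff => //; exact: holds_same.
    by rewrite (tr_Live codeM h0' hm' hu (holds_same _ _ _)) markM.
  rewrite tr_Eq eval_Count tr_Pos; congr (_ == nat_of_bool _); last first.
    exact: tr_OddDegree.
  - apply: eq_card => t; rewrite !inE tr_And tr_Not.
    have h0 : holds (updS E 1 t) 0 s by exact: holds_diff.
    have ht : holds (updS E 1 t) 1 t by exact: holds_same.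
    by rewrite (tr_Same M ht h0) (tr_OddDegree _ _ h0 ht).
rewrite tr_Ex; apply: eq_existsb => t.
have h0 : holds (updS E 1 t) 0 s by exact: holds_diff.
have ht : holds (updS E 1 t) 1 t by exact: holds_same.
rewrite 2!tr_And tr_Not (tr_Same M ht h0) (tr_Mark o M ht) markM.
congr [&& _, _ & _]; rewrite tr_Eq.
have hc : eval n M (eCount 2 (eEnemy o 2)) (updS E 1 t) = #|enemy p s|.
  rewrite eval_Count; apply: eq_card => m; rewrite inE.
  by rewrite (tr_Enemy codeM (holds_diff _ _ h0) (holds_same _ _ _)).
by rewrite -{1 2}hc; case: ht h0 => /= -> _ [-> _].
Qed.

End Acceptance.

(** * Loops over all squares *)

Fixpoint writes (c : cmd) (v : nat) : bool :=
  match c with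
  | CAssign w _ => v == w
  | CStore _ _ => false
  | CIf _ c => writes c v
  | CSeq c1 c2 => writes c1 v || writes c2 v
  | CFor w c => (v == w) || writes c v
  end.

Section Loops.

Variable n : nat.

Lemma den_frame c v st : ~~ writes c v -> (den n c st).1 v = st.1 v.
Proof.
elim: c st => [w e|e1 e2|e c IH|c1 IH1 c2 IH2|w c IH] st //=.
- exact: upd_diff.
- by move=> h; case: ifP => // _; exact: IH.
- by case/norP=> h1 h2; rewrite IH2 // IH1.
case/norP=> vw h; rewrite upd_diff //.
by elim: (iota 0 n) st => //= i r IHr st; rewrite IHr IH //= upd_diff.
Qed.

Lemma den_If e c E M :
  den n (CIf e c) (E, M) = if tr n M e E then den n c (E, M) else (E, M).
Proof. by []. Qed.

Lemma den_Seq c1 c2 st : den n (CSeq c1 c2) st = den n c2 (den n c1 st).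
Proof. by []. Qed.

Lemma for_count v c (I : nat -> state -> Prop) st :
    (forall k E M x, I k (E, M) -> I k (upd E v x, M)) ->
    (forall k st, k < n -> I k st -> st.1 v = k -> I k.+1 (den n c st)) ->
  I 0 st -> I n (den n (CFor v c) st).
Proof.
move=> stable body I0 /=.
have main k : k <= n ->
    I k (foldl (fun st i => den n c (upd st.1 v i, st.2)) st (iota 0 k)).
  elim: k => // k IH lt_kn; rewrite -addn1 iotaD foldl_cat /= addn1.
  apply: body => //; last by rewrite /= upd_same.
  by move: (IH (ltnW lt_kn)); case: foldl => E M; exact: stable.
by move: (main n (leqnn n)); case: foldl => E M; exact: stable.
Qed.

(** Squares are visited in the order of [offset], so the offset of a square is the number of passes
    made before it. *)
Lemma forS_count a c (I : nat -> state -> Prop) st :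
    (forall k E M b x, b \in [:: rowv a; colv a] ->
       I k (E, M) -> I k (upd E b x, M)) ->
    ~~ writes c (rowv a) ->
    (forall (u : square n) st, I (offset u) st -> holds st.1 a u ->
       I (offset u).+1 (den n c st)) ->
  I 0 st -> I (n * n) (den n (cForS a c) st).
Proof.
move=> stable frame body I0.
have rc : rowv a != colv a by rewrite /rowv /colv; lia.
apply: (@for_count _ _ (fun i => I (n * i))).
- by move=> i E M x; apply: stable; rewrite inE eqxx.
- move=> i {I0}st lt_in Ii ri; rewrite mulnS addnC.
  suff [] : I (n * i + n) (den n (CFor (colv a) c) st) /\
      (den n (CFor (colv a) c) st).1 (rowv a) = i by [].
  apply: (@for_count _ _
    (fun j st => I (n * i + j) st /\ st.1 (rowv a) = i)) => //.
  + move=> j E M x [h1 h2]; split; last by rewrite /= upd_diff.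
    by apply: stable h1; rewrite !inE eqxx orbT.
  + move=> j st' lt_jn [h1 h2] h3; split; last by rewrite den_frame.
    rewrite addnS; apply: (body (Ordinal lt_in, Ordinal lt_jn)) => //.
  by rewrite addn0.
by rewrite muln0.
Qed.

(* D u is what the pass over square u establishes and later passes keep. *)
Lemma forS_inv a c (Inv : state -> Prop) (D : square n -> state -> Prop) st :
    (forall E M b x, b \in [:: rowv a; colv a] ->
       Inv (E, M) -> Inv (upd E b x, M)) ->
    (forall u E M b x, b \in [:: rowv a; colv a] ->
       D u (E, M) -> D u (upd E b x, M)) ->
    ~~ writes c (rowv a) ->
    (forall u st, Inv st -> holds st.1 a u ->
       [/\ Inv (den n c st), D u (den n c st)
         & forall w, D w st -> D w (den n c st)]) ->
  Inv st ->
  Inv (den n (cForS a c) st) /\ forall u, D u (den n (cForS a c) st).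
Proof.
move=> sI sD frame body I0.
have [||||h1 h2] := @forS_count a c
  (fun k st => Inv st /\ forall u, offset u < k -> D u st) st.
- move=> k E M b x hb [h1 h2]; split; first exact: sI.
  by move=> u /h2; exact: sD.
- exact: frame.
- move=> u {I0}st [h1 h2] hu; have [i1 i2 i3] := body _ _ h1 hu.
  split=> // w; rewrite ltnS leq_eqVlt => /orP[/eqP/offset_inj->//|/h2/i3//].
- by [].
by split=> // u; apply: h2; exact: offset_lt.
Qed.

End Loops.

(** * Reachability by rounds of marking *)

Section Search.

Variables (n : nat) (p : board n) (o : nat) (M0 : nat -> nat).
Variables (sel acc : expr) (S A : pred (square n)).

Definition intact (M : nat -> nat) : Prop :=
  forall a, a < o + n * n -> M a = M0 a.

Hypothesis codeM0 : forall u, M0 (o + offset u) = code p u.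
Hypothesis selE : forall s M E, intact M -> holds E 0 s -> tr n M sel E = S s.
Hypothesis accE : forall s M E, intact M -> holds E 0 s ->
  (forall u, mark o M u = reach p s u) -> tr n M acc E = A s.

Lemma intact_code M u : intact M -> M (o + offset u) = code p u.
Proof. by move=> ok; rewrite ok ?codeM0 // ltn_add2l offset_lt. Qed.

Lemma intact_upd M (u : square n) x :
  intact M -> intact (upd M (o + n * n + offset u) x).
Proof. by move=> ok a lt_a; rewrite upd_diff ?ok //; lia. Qed.

Lemma mark_upd M (u w : square n) x :
  mark o (upd M (o + n * n + offset u) x) w = if w == u then 0 < x else mark o M w.
Proof.
by rewrite /mark /upd eqn_add2l (inj_eq (@offset_inj n)); case: eqP.
Qed.

Lemma den_Store a x E M (u : square n) : holds E a u ->
  den n (CStore (eCell o a) (EConst x)) (E, M) = (E, upd M (o + n * n + offset u) x).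
Proof. by move=> h; rewrite -(eval_Cell M o h). Qed.

Section Start.

Variable s : square n.

Definition level (k : nat) (u : square n) : Prop :=
  exists q, [/\ path (fun u v => [exists m, capture p s m u v]) s q,
    last s q = u & size q <= k].

(** Marks are set in place, so a round may advance by several levels at once. Completeness is
    therefore stated by level, but soundness only by plain reachability. *)
Definition marking (k : nat) (st : state) : Prop :=
  [/\ intact st.2, holds st.1 0 s, forall u, mark o st.2 u -> reach p s u
    & forall u, level k u -> mark o st.2 u].

Lemma marking_upd k E M b x : 2 < b -> marking k (E, M) -> marking k (upd E b x, M).
Proof.
move=> b2 [h1 [h2 h2'] h3 h4]; split=> //.
by split; rewrite /= upd_diff // /rowv /colv; lia.
Qed.

Lemma levelS k u : level k.+1 u ->
  u = s \/ exists2 v, level k v & [exists m, capture p s m v u].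
Proof.
case=> q []; case/lastP: q => [|q w] /=; first by left.
rewrite rcons_path last_rcons size_rcons ltnS => /andP[pq c] <- le_q.
by right; exists (last s q) => //; exists q.
Qed.

Lemma den_Round k st : marking k st -> marking k.+1 (den n (cRound o) st).
Proof.
have big b : b \in [:: rowv 1; colv 1] -> 2 < b.
  by rewrite !inE => /orP[] /eqP->.
move=> h; have [|||||h1 h2] := @forS_inv n 1
    (CIf (bEx 2 (bEx 3 (eLive o 2 3 1))) (CStore (eCell o 1) (EConst 1)))
    (marking k) (fun u st => level k.+1 u -> mark o st.2 u) st.
- by move=> E M b x /big; exact: marking_upd.
- by [].
- by [].
- move=> u [E M] mk hu; have [ok hs sound lev] := mk.
  have cond : tr n M (bEx 2 (bEx 3 (eLive o 2 3 1))) E =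
      [exists m, exists v, mark o M v && capture p s m v u].
    rewrite tr_Ex; apply: eq_existsb => m; rewrite tr_Ex; apply: eq_existsb => v.
    have hs' : holds (updS (updS E 2 m) 3 v) 0 s by do 2 apply: holds_diff => //.
    have hu' : holds (updS (updS E 2 m) 3 v) 1 u by do 2 apply: holds_diff => //.
    have hm : holds (updS (updS E 2 m) 3 v) 2 m.
      by apply: holds_diff => //; exact: holds_same.
    by rewrite (tr_Live (fun u => intact_code u ok) hs' hm (holds_same _ _ _) hu').
  rewrite den_If cond.
  case: ifP => [/existsP[m /existsP[v /andP[mv c]]]|no].
    rewrite (den_Store _ _ hu); split=> /=.
    + split=> //=; first exact: intact_upd.
      * move=> w; rewrite mark_upd; case: eqP => [-> _|_]; last exact: sound.
        apply: connect_trans (sound _ mv) (connect1 _).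
        by apply/existsP; exists m.
      * by move=> w /lev; rewrite mark_upd; case: eqP.
    + by rewrite mark_upd eqxx.
    by move=> w h' /h'; rewrite mark_upd; case: eqP.
  split=> // /levelS[->|[v lv /existsP[m c]]].
    by apply: lev; exists [::].
  move/negbT/existsPn/(_ m): no; case/negP; apply/existsP; exists v.
  by rewrite lev.
- exact: h.
by case: h1 => ? ? ? _; split.
Qed.

(** A path shortened to distinct squares has fewer than [n * n] steps, so that many rounds
    suffice. *)
Lemma reach_level u : reach p s u -> level (n * n) u.
Proof.
case/connectP=> q + ->; case/shortenP=> q' pq' uq' _.
exists q'; split=> //.
have := card_uniqP uq'; have := max_card (mem (s :: q')).
by rewrite card_prod card_ord /= => h1 h2; rewrite ltnW // -h2.
Qed.

Lemma den_Start st : intact st.2 -> holds st.1 0 s ->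
  let st' := den n (CSeq (cForS 1 (CStore (eCell o 1) (EConst 0)))
    (CSeq (CStore (eCell o 0) (EConst 1)) (cForS 5 (cRound o)))) st in
  [/\ intact st'.2, holds st'.1 0 s & forall u, mark o st'.2 u = reach p s u].
Proof.
move=> ok hs st'.
have frame c v : ~~ writes c v -> (den n c st).1 v = st.1 v by exact: den_frame.
rewrite {}/st' !den_Seq.
set st1 := den n (cForS 1 _) st.
have [|||||ok1 none1] := @forS_inv n 1 (CStore (eCell o 1) (EConst 0))
  (fun st => intact st.2) (fun u st => ~~ mark o st.2 u) st.
- by [].
- by [].
- by [].
- move=> u [E M] okM hu; rewrite (den_Store _ _ hu); split=> /=.
  + exact: intact_upd.
  + by rewrite mark_upd eqxx.
  by move=> w; rewrite mark_upd; case: eqP.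
- exact: ok.
rewrite -/st1 in ok1 none1.
have hs1 : holds st1.1 0 s by case: hs => *; split; rewrite frame.
case: st1 ok1 none1 hs1 => E1 M1 ok1 none1 hs1; rewrite (den_Store _ _ hs1).
have mk0 : marking 0 (E1, upd M1 (o + n * n + offset s) 1).
  split=> //=; first exact: intact_upd.
    move=> u; rewrite mark_upd; case: eqP => [-> _|_ mu]; first exact: connect0.
    by rewrite (negbTE (none1 u)) in mu.
  by move=> u [q []]; case: q => // _ <- _; rewrite mark_upd eqxx.
have [|||ok2 hs2 sound lev] := @forS_count n 5 (cRound o) marking _ _ _ _ mk0.
- move=> k E M b x hb; apply: marking_upd.
  by move: hb; rewrite !inE => /orP[] /eqP->.
- by [].
- by move=> u st2 mk _; exact: den_Round.
by split=> // u; apply/idP/idP => [/sound//|/reach_level/lev].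
Qed.

End Start.

Lemma den_Search :
  0 < (den n (cSearch o sel acc) (fun=> 0, M0)).1 0 <-> exists s, S s && A s.
Proof.
(* The answer is only ever set to 1, so success at one start survives all later passes. *)
have [|||||[ok yes] done] := @forS_inv n 0
  (CIf sel
    (CSeq (cForS 1 (CStore (eCell o 1) (EConst 0)))
    (CSeq (CStore (eCell o 0) (EConst 1))
    (CSeq (cForS 5 (cRound o))
          (CIf acc (CAssign 0 (EConst 1)))))))
  (fun st => intact st.2 /\ (0 < st.1 0 -> exists s, S s && A s))
  (fun s st => S s && A s -> 0 < st.1 0) (fun=> 0, M0).
- move=> E M b x hb; rewrite /= upd_diff //.
  by move: hb; rewrite !inE => /orP[] /eqP->.
- move=> s E M b x hb; rewrite /= upd_diff //.
  by move: hb; rewrite !inE => /orP[] /eqP->.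
- by [].
- move=> s [E M] [ok yes] hs.
  rewrite den_If (selE ok hs).
  case: ifP => [Ss|nSs]; last by split.
  have := den_Start ok hs; rewrite !den_Seq; set st' := den n (cForS 5 _) _.
  have st'0 : st'.1 0 = E 0 by rewrite !den_frame.
  case: st' st'0 => E' M' st'0 [ok' hs' mk]; rewrite den_If (accE ok' hs' mk).
  case: ifP => [As|nAs] /=.
    by split=> //; split=> // _; exists s; rewrite Ss.
  by rewrite /= in st'0; rewrite st'0; split.
- by split.
split=> [/yes//|[s Hs]]; exact: done Hs.
Qed.

End Search.

(** * Reading the input, and the two decision programs *)

Lemma nth_allpairs (T1 T2 T3 : Type) (f : T1 -> T2 -> T3) x1 x2 x3 r t i j :
  i < size r -> j < size t ->
  nth x3 [seq f x y | x <- r, y <- t] (size t * i + j) = f (nth x1 r i) (nth x2 t j).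
Proof.
elim: r i => // x r IH [|i] /= lt_i lt_j; rewrite nth_cat size_map.
  by rewrite muln0 add0n lt_j (nth_map x2).
have -> : size t * i.+1 + j < size t = false by rewrite mulnS; lia.
by have -> : size t * i.+1 + j - size t = size t * i + j; [lia | exact: IH].
Qed.

Lemma nth_code_board n (p : board n) (u : square n) :
  nth 0 (code_board p) (offset u) = code p u.
Proof.
case: u => i j; rewrite /offset /code_board /=.
have := @nth_allpairs _ _ _ (fun i j => code_square (p (i, j))) i j 0
  (enum 'I_n) (enum 'I_n) i j.
by rewrite !size_enum_ord !nth_ord_enum => ->.
Qed.

(** The polynomial is fixed before the board is known, as it comes from the program text alone. *)
Lemma searchP (o : nat) (sel acc : expr) : exists T : {poly nat},
  forall n (p : board n) (input : seq nat) (S A : pred (square n)) (Q : Prop),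
    nth 0 input 0 = n ->
    (forall u, nth 0 input (o + offset u) = code p u) ->
    (forall s M E, intact n o (nth 0 input) M -> holds E 0 s ->
       tr n M sel E = S s) ->
    (forall s M E, intact n o (nth 0 input) M -> holds E 0 s ->
       (forall u, mark o M u = reach p s u) -> tr n M acc E = A s) ->
    ((exists s, S s && A s) <-> Q) ->
  decides_within (compile (cSearch o sel acc)) input (T.[n])%R Q.
Proof.
have [T hT] := compile_ok (cSearch o sel acc); exists T.
move=> n p input S A Q hn hp hS hA hQ; apply: hT hn _.
by rewrite -hQ; exact: den_Search hp hS hA.
Qed.

Theorem theorem2 :
  (exists (P : program) (T : {poly nat}),
     forall (n : nat) (p : board n) (s : square n) (c : color),
       position p -> p s = Some (c, Man) ->
       decides_within P (king_input p s) (T.[n])%R (can_become_king p s c))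
  /\
  (exists (P : program) (T : {poly nat}),
     forall (n : nat) (p : board n) (c : color),
       position p ->
       decides_within P (win_input p c) (T.[n])%R (can_win_at_once p c)).
Proof.
split.
  (* The header consists of [n], a row and a column, so the board begins at cell 3; the search is
     confined to the given square. *)
  pose sel := bAnd (bEq (EVar (rowv 0)) (ELoad (EConst 1)))
                   (bEq (EVar (colv 0)) (ELoad (EConst 2))).
  have [T hT] := searchP 3 sel (ePromotes 3).
  exists (compile (cSearch 3 sel (ePromotes 3))), T => n p s c _ ps.
  apply: (hT n p _ (pred1 s) (promotes p)) => //.
  - by move=> u; rewrite -nth_code_board.
  - move=> w M E ok [h1 h2]; rewrite tr_And !tr_Eq /= h1 h2 square_eqE.
    by rewrite !ok.
  - move=> w M E ok hs mk; apply: tr_Promotes mk hs _ => [u|]; last by rewrite ok.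
    exact: (@intact_code n p 3 (nth 0 (king_input p s)) (fun u => nth_code_board p u)).
  rewrite (promotesE ps erefl); split=> [[w /andP[/eqP->]]//|h].
  by exists s; rewrite /= eqxx.
(* Here the header is [n] and a colour, so the board begins at cell 2; every piece of that colour is
   tried. *)
pose sel := bAnd (eCode 2 0) (bEq (bPos (eBlack 2 0)) (ELoad (EConst 1))).
have [T hT] := searchP 2 sel (eWins 2).
exists (compile (cSearch 2 sel (eWins 2))), T => n p c _.
have codeM M : intact n 2 (nth 0 (win_input p c)) M ->
    forall u, M (2 + offset u) = code p u.
  move=> ok u; apply: (@intact_code n p 2 (nth 0 (win_input p c))) => // w.
  exact: nth_code_board.
apply: (hT n p _ (fun s => (0 < code p s) && (black p s == code_color c :> nat))
  (wins p)) => //.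
- by move=> u; rewrite -nth_code_board.
- move=> s M E ok hs; rewrite tr_And tr_Eq tr_Pos (tr_Black (codeM _ ok) hs) /=.
  by rewrite /tr (eval_Code (codeM _ ok) hs) ok.
- by move=> s M E ok hs mk; apply: tr_Wins (codeM _ ok) mk hs.
split=> [[s /andP[/andP[s0 /eqP sc] ws]]|[s [k [q [t [ps mv none]]]]]].
  have [k ps] : exists k, p s = Some (c, k).
    move: s0 sc; rewrite /black /code.
    by case: (p s) => [[[] k]|] // _; case: {codeM} c k => [] [] //= _; eexists.
  have [q [t [mv none]]] := proj2 (winsE ps) ws.
  by exists s, k, q, t.
exists s; rewrite (proj1 (winsE ps)) ?andbT; last by exists q, t.
by rewrite /black /code ps; clear; case: c k => [] [].
Qed.
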